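(* Let $k$ be an algebraically closed field of characteristic $p>0$, let $n\geq 1$, and let $M$ be a finite-dimensional $k\Sigma_n$-module, where $\Sigma_n$ is the symmetric group on $n$ letters. Then the following three quantities are equal: (a) the complexity $c_{\Sigma_n}(M)$; (b) $\max_{\lambda\vDash n}\{\gamma(\mathrm{H}^\bullet(\Sigma_\lambda,M))\}$; (c) $\max_{\lambda\vDash n}\{\gamma(\mathrm{H}_\bullet(\Sigma_\lambda,M))\}$.
   Context: The notation $\lambda\vDash n$ means that $\lambda=(\lambda_1,\dots,\lambda_l)$ is a composition of $n$, i.e. a finite sequence of positive integers with sum $n$. The associated Young subgroup is $\Sigma_\lambda\cong\Sigma_{\lambda_1}\times\cdots\times\Sigma_{\lambda_l}\leq\Sigma_n$, and $M$ is regarded as a $k\Sigma_\lambda$-module by restriction. For a finite group $G$ and a $kG$-module $M$, $\mathrm{H}^\bullet(G,M)=\operatorname{Ext}^\bullet_{kG}(k,M)$ and $\mathrm{H}_\bullet(G,M)=\operatorname{Tor}_\bullet^{kG}(k,M)$. The rate of growth $\gamma(V_\bullet)$ of a sequence $V_\bullet=\{V_t : t=0,1,2,\dots\}$ of finite-dimensional vector spaces is the smallest non-negative integer $c$ for which there is a constant $K$ such that $\dim V_t\leq K\cdot t^{c-1}$ for all $t\geq 1$. In particular $\gamma(V_\bullet)=0$ if and only if $V_t=0$ for all sufficiently large $t$. For a finite group $G$ and a finite-dimensional $kG$-module $M$ with minimal projective resolution $P_\bullet\to M$, the complexity of $M$ is $c_G(M)=\gamma(P_\bullet)$. *)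

(* Defs.v *)
From HB Require Import structures.
From mathcomp Require Import all_boot all_order all_fingroup all_algebra.
From mathcomp Require Import mxrepresentation.
From mathcomp Require Import boolp constructive_ereal.

Set Implicit Arguments.
Unset Strict Implicit.
Unset Printing Implicit Defensive.

Import Order.TTheory GRing.Theory Num.Theory GroupScope.
Local Open Scope ring_scope.

(* A finite-dimensional kG-module is a matrix representation of G; matrices act
   on row vectors, on the right, so a left module is encoded by letting x act
   as x^-1 does.  A matrix f : 'M_(a, b) is the linear map v |-> v *m f. *)

Section Modules.
Variables (k : fieldType) (gT : finGroupType) (G : {group gT}).

Lemma triv_mx_repr : mx_repr G (fun _ : gT => 1%:M : 'M[k]_1).
Proof. by split=> [|x y _ _] //; rewrite mulmx1. Qed.
Definition triv_repr : mx_representation k G 1 := MxRepresentation triv_mx_repr.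

Definition homG a b (A : mx_representation k G a) (B : mx_representation k G b)
    : {vspace 'M[k]_(a, b)} :=
  (\bigcap_(x in G) lker (linfun (mulmx (A x) \- mulmxr (B x))))%VS.

Lemma homGP a b (A : mx_representation k G a) (B : mx_representation k G b) f :
  reflect {in G, forall x, A x *m f = f *m B x} (f \in homG A B).
Proof.
have memE x : (f \in lker (linfun (mulmx (A x) \- mulmxr (B x))))
    = (A x *m f == f *m B x).
  by rewrite memv_ker lfunE subr_eq0.
rewrite /homG memvE; apply: (iffP subv_bigcapP) => H x Gx.
  by apply/eqP; rewrite -memE memvE H.
by rewrite -memvE memE H.
Qed.

(* The kernel of A (x)_k B -> A (x)_{kG} B, where v (x) w is v^T *m w: the
   quotient is the space of coinvariants of the diagonal action, because the
   left action of x on B is the right action of x^-1. *)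
Definition tensG_rel a b (A : mx_representation k G a)
    (B : mx_representation k G b) : {vspace 'M[k]_(a, b)} :=
  (\sum_(x in G) limg (linfun (mulmx (A x)^T \o mulmxr (B x) \- idfun)))%VS.

Lemma mem_tensG_rel a b (A : mx_representation k G a)
    (B : mx_representation k G b) x (v : 'rV_a) (w : 'rV_b) : x \in G ->
  (v *m A x)^T *m (w *m B x) - v^T *m w \in tensG_rel A B.
Proof.
move=> Gx; apply: (subvP (sumv_sup x Gx (subvv _))).
set F := linfun _.
suff ->: (v *m A x)^T *m (w *m B x) - v^T *m w = F (v^T *m w).
  exact/memv_img/memvf.
by rewrite lfunE /= trmx_mul !mulmxA.
Qed.

Definition projective a (P : mx_representation k G a) : Prop :=
  forall b c (B : mx_representation k G b) (C : mx_representation k G c)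
         (g : 'M[k]_(b, c)) (f : 'M[k]_(a, c)),
    g \in homG B C -> row_full g -> f \in homG P C ->
    exists2 h : 'M[k]_(a, b), h \in homG P B & h *m g = f.

Record resolution m (M : mx_representation k G m) : Type := Resolution {
  rdim : nat -> nat;
  rmod : forall t, mx_representation k G (rdim t);
  rdif : forall t, 'M[k]_(rdim t.+1, rdim t);
  raug : 'M[k]_(rdim 0, m);
  rmod_projective : forall t, projective (rmod t);
  rdif_hom : forall t, rdif t \in homG (rmod t.+1) (rmod t);
  raug_hom : raug \in homG (rmod 0) M;
  raug_onto : row_full raug;
  rdif_exact0 : (rdif 0 == kermx raug)%MS;
  rdif_exact : forall t, (rdif t.+1 == kermx (rdif t))%MS
}.

(* f is an essential epimorphism onto its image. *)
Definition essential a b (A : mx_representation k G a) (f : 'M[k]_(a, b)) :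
    Prop :=
  forall U : 'M[k]_a, mxmodule A U -> (f <= U *m f)%MS -> row_full U.

(* Each term is a projective cover of the syzygy it maps onto. *)
Definition minimal m (M : mx_representation k G m) (P : resolution M) : Prop :=
  essential (rmod P 0) (raug P) /\
  forall t, essential (rmod P t.+1) (rdif P t).

Section ExtTor.
Variables (a : nat) (A : mx_representation k G a) (Q : resolution A).
Variables (m : nat) (M : mx_representation k G m).

(* Dimension of Ext^t_{kG}(A, M), as the cohomology of Hom_{kG}(Q, M). *)
Definition dim_Ext (t : nat) : nat :=
  (\dim (homG (rmod Q t) M :&: lker (linfun (mulmx (rdif Q t))))
   - if t is s.+1
     then \dim (linfun (mulmx (rdif Q s)) @: homG (rmod Q s) M) else 0)%N.

Definition tens_cycles (t : nat) : {vspace 'M[k]_(rdim Q t, m)} :=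
  match t with
  | 0 => fullv
  | s.+1 => (linfun (mulmx (rdif Q s)^T) @^-1: tensG_rel (rmod Q s) M)%VS
  end.

Definition tens_boundaries (t : nat) : {vspace 'M[k]_(rdim Q t, m)} :=
  (limg (linfun (mulmx (rdif Q t)^T)) + tensG_rel (rmod Q t) M)%VS.

(* Dimension of Tor_t^{kG}(A, M), as the homology of Q (x)_{kG} M; cycles and
   boundaries are taken before passing to the quotient by tensG_rel. *)
Definition dim_Tor (t : nat) : nat :=
  (\dim (tens_cycles t) - \dim (tens_boundaries t))%N.

End ExtTor.
End Modules.

Definition growth_le (V : nat -> nat) (c : nat) : Prop :=
  exists K : rat, forall t : nat, (0 < t)%N ->
    (V t)%:R <= K * t%:R ^ (c%:Z - 1).

(* The argument V is the sequence of dimensions; the value is +oo when no c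
   exists, so that the rate of growth is defined for every sequence. *)
Definition growth_rate (V : nat -> nat) : \bar int :=
  match pselect (exists c, `[< growth_le V c >]) with
  | left exc => (ex_minn exc)%:Z%:E
  | right _ => +oo%E
  end.

Definition composition (n : nat) (l : seq nat) : bool :=
  all (leq 1) l && (sumn l == n).

(* The permutations preserving each of the consecutive blocks of lengths
   l_1, l_2, ...; reshape_index l i is the index of the block of i. *)
Definition young_set (n : nat) (l : seq nat) : {set 'S_n} :=
  [set s : 'S_n | [forall i : 'I_n, reshape_index l (s i) == reshape_index l i]].

Lemma young_group_set n l : group_set (young_set n l).
Proof.
apply/group_setP; split=> [|s t]; rewrite !inE.
  by apply/forallP=> i; rewrite perm1.
move=> /forallP hs /forallP ht; apply/forallP=> i.
by rewrite permM (eqP (ht _)) (eqP (hs _)).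
Qed.
Canonical young (n : nat) (l : seq nat) : {group 'S_n} :=
  Group (young_group_set n l).

Definition young_res (k : fieldType) n m
    (M : mx_representation k [set: 'S_n] m) (l : seq nat) :
    mx_representation k (young n l) m :=
  subg_repr M (subsetT (young n l)).

Definition is_max (I : Type) (P : I -> Prop) (F : I -> \bar int)
    (x : \bar int) : Prop :=
  (exists2 i, P i & F i = x) /\ forall i, P i -> (F i <= x)%E.

(* Main.v *)
Require Import Defs.
From HB Require Import structures.
From mathcomp Require Import all_boot all_order all_fingroup all_algebra.
From mathcomp Require Import mxrepresentation zify.
From mathcomp Require Import boolp constructive_ereal.

Set Implicit Arguments.
Unset Strict Implicit.
Unset Printing Implicit Defensive.

Import Order.TTheory GRing.Theory Num.Theory GroupScope.
Local Open Scope ring_scope.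

(** Write G for the symmetric group, H for a Young subgroup and A^* for the dual of
    a module A. The proof rests on three facts.

    First, the complexity of M is at most c if and only if Ext^t_G(M, N) has growth
    at most c for every module N (minimal_grows). In a minimal resolution P the
    maps Hom(P_t, N) have zero differentials when N is simple, so Ext^t(M, N) is
    Hom(P_t, N); by left exactness a bound for simple N gives a bound on
    Hom(P_t, kG), whose dimension is that of P_t.

    Second, M and M^* satisfy this condition together (sdim_dual_chain). By the
    triangle identity of duality M^* is a direct summand of M^* (x) M (x) M^*, so
    Ext^t(M^*, N) is a direct summand of Ext^t(M, M (x) M (x) N).

    Third, the permutation modules k[G/H] on cosets of Young subgroups generate all
    modules under two-out-of-three for short exact sequences (young_generation).
    By James's theory, with the shapes taken in decreasing order, M^lambda contains
    the orthogonal O of the Specht module E. The module O is a sum of images of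
    M^mu with mu larger, M^lambda / E embeds in a sum of such M^mu, and
    (E + O) / O is simple or zero. If every subquotient of every M^mu with mu
    larger is generated, then so are O and M^lambda / (E + O), hence
    (E + O) / O, and with it every subquotient of M^lambda. The last M^lambda is kG.

    Now the modules N for which Ext^t_G(M, N) has growth at most c are closed under
    two-out-of-three, by the long exact sequence. So it is enough to test N =
    k[G/H], where Ext^t_G(M, k[G/H]) = Ext^t_H(M, k) = Ext^t_H(k, M^* ) is dual to
    Tor_t^H(k, M). This proves the statement on homology, and applied to M^* it
    proves the statement on cohomology.

    Throughout, Ext^t(A, N) for t > 0 is handled as the space of stable homs from
    a t-th syzygy of A to N, that is, homs modulo traces of linear maps, so that
    exact sequences become identities between dimensions of spaces of homs. *)

(** * Stable homs and short exact sequences *)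

Section DimensionCount.
Variables (k : fieldType) (aT bT cT : vectType k).
Variables (U : {vspace aT}) (V : {vspace bT}) (W : {vspace cT}).
Variables (i : {linear aT -> bT}) (l : {linear bT -> cT}).
Hypothesis iV : forall u, u \in U -> i u \in V.
Hypothesis i_inj : forall u, u \in U -> i u = 0 -> u = 0.
Hypothesis li0 : forall u, u \in U -> l (i u) = 0.
Hypothesis ker_l : forall v, v \in V -> l v = 0 -> exists2 u, u \in U & v = i u.
Hypothesis lW : forall v, v \in V -> l v \in W.

Lemma dim_ker_img : (\dim V = \dim U + \dim (linfun l @: V))%N.
Proof.
rewrite -(limg_ker_dim (linfun l) V); congr (_ + _)%N.
have -> : (V :&: lker (linfun l) = linfun i @: U)%VS.
  apply/vspaceP=> v; rewrite memv_cap memv_ker lfunE /=.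
  apply/andP/memv_imgP => [[Vv /eqP /(ker_l Vv) [u Uu ->]]|[u Uu ->]].
    by exists u; rewrite // lfunE.
  by rewrite lfunE /= iV // li0.
rewrite limg_dim_eq //; apply/eqP; rewrite -subv0; apply/subvP=> u.
rewrite memv_cap memv_ker lfunE memv0 => /andP[Uu /eqP /i_inj ->] //.
Qed.

Lemma dim_exact : (forall w, w \in W -> exists2 v, v \in V & l v = w) ->
  (\dim V = \dim U + \dim W)%N.
Proof.
move=> onto; rewrite dim_ker_img; congr (_ + \dim _)%N.
apply/vspaceP=> w; apply/memv_imgP/idP=> [[v Vv ->]|/onto[v Vv <-]].
  by rewrite lfunE /= lW.
by exists v; rewrite ?lfunE.
Qed.

End DimensionCount.

Lemma eq_dim_bij (k : fieldType) (aT bT : vectType k) (U : {vspace aT})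
    (V : {vspace bT}) (i : {linear aT -> bT}) :
    (forall u, u \in U -> i u \in V) ->
    (forall u, u \in U -> i u = 0 -> u = 0) ->
    (forall v, v \in V -> exists2 u, u \in U & v = i u) ->
  \dim U = \dim V.
Proof.
move=> iV i_inj onto; have -> : V = (linfun i @: U)%VS.
  apply/vspaceP=> v; apply/idP/memv_imgP=> [/onto[u Uu ->]|[u Uu ->]].
    by exists u; rewrite ?lfunE.
  by rewrite lfunE /= iV.
rewrite limg_dim_eq //; apply/eqP; rewrite -subv0; apply/subvP=> u.
by rewrite memv_cap memv_ker lfunE memv0 => /andP[Uu /eqP /i_inj ->].
Qed.

Section StableHoms.
Variables (k : fieldType) (gT : finGroupType) (G : {group gT}).
Local Notation rep a := (mx_representation k G a).

(** Bundling the dimension lets the terms of a resolution and the syzygies, whose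
    dimensions vary, form sequences. *)
Record gmod := GMod { gdim : nat; grep :> rep gdim }.

Definition ghom (A B : gmod) (f : 'M[k]_(gdim A, gdim B)) : Prop :=
  {in G, forall x, A x *m f = f *m B x}.

Implicit Types A B C N X Y Z Q : gmod.

Lemma ghom_mul A B C f g : @ghom A B f -> @ghom B C g -> ghom (f *m g).
Proof. by move=> hf hg x Gx; rewrite mulmxA hf // -!mulmxA hg. Qed.

Lemma ghom1 A : @ghom A A 1%:M.
Proof. by move=> x _; rewrite mulmx1 mul1mx. Qed.

Lemma ghom0 A B : @ghom A B 0.
Proof. by move=> x _; rewrite mulmx0 mul0mx. Qed.

(** The maps trc f are the homs that factor through a projective module, so sdim
    below is the dimension of the space of stable homs. *)
Definition trc A B (f : 'M[k]_(gdim A, gdim B)) : 'M[k]_(gdim A, gdim B) :=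
  \sum_(x in G) A x^-1%g *m f *m B x.

Lemma trc_is_linear A B : linear (@trc A B).
Proof.
move=> a f g; rewrite /trc scaler_sumr -big_split; apply: eq_bigr => x _ /=.
by rewrite mulmxDr mulmxDl -scalemxAr -scalemxAl.
Qed.
HB.instance Definition _ A B :=
  GRing.isLinear.Build k _ _ *:%R (@trc A B) (@trc_is_linear A B).

Lemma trc_hom A B f : ghom (@trc A B f).
Proof.
move=> y Gy; rewrite /trc mulmx_sumr mulmx_suml.
rewrite (reindex_inj (mulIg y)); apply: eq_big => [x|x Gx]; first by rewrite groupMr.
rewrite groupMr // in Gx.
rewrite -[RHS]mulmxA -repr_mxM // !mulmxA -repr_mxM ?groupV ?groupM //.
by rewrite invMg mulgA mulgV mul1g.
Qed.

Lemma trc_mulr A B C f g : @ghom B C g -> @trc A B f *m g = @trc A C (f *m g).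
Proof.
move=> hg; rewrite /trc mulmx_suml; apply: eq_bigr => x Gx.
by rewrite -!mulmxA hg.
Qed.

Lemma trc_mull A B C f g : @ghom C A g -> g *m @trc A B f = @trc C B (g *m f).
Proof.
move=> hg; rewrite /trc mulmx_sumr; apply: eq_bigr => x Gx.
by rewrite !mulmxA hg ?groupV.
Qed.

(** Higman's criterion for projectivity. *)
Definition relproj A := exists th, @trc A A th = 1%:M.

Definition hdim A B := \dim (homG A B).
Definition tdim A B := \dim (limg (linfun (@trc A B))).
Definition sdim A B := (hdim A B - tdim A B)%N.

Lemma memh A B f : reflect (@ghom A B f) (f \in homG A B).
Proof. exact: homGP. Qed.

Lemma trcP A B u :
  reflect (exists f, u = @trc A B f) (u \in limg (linfun (@trc A B))).
Proof.
apply: (iffP memv_imgP) => [[f _ ->]|[f ->]]; first by exists f; rewrite lfunE.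
by exists f; rewrite ?memvf ?lfunE.
Qed.

Lemma tdim_le A B : (tdim A B <= hdim A B)%N.
Proof.
by apply/dimvS/subvP=> _ /trcP[f ->]; apply/memh/trc_hom.
Qed.

(** Short exact sequences come with a linear, not equivariant, splitting: kernels
    and cokernels then reduce to matrix identities. *)
Record ses A B C (f : 'M_(gdim A, gdim B)) (g : 'M_(gdim B, gdim C)) : Prop :=
  Ses {
  ses_homl : ghom f;
  ses_homr : ghom g;
  ses_split : exists r s, [/\ f *m r = 1%:M, s *m g = 1%:M, f *m g = 0,
                              s *m r = 0 & r *m f + g *m s = 1%:M] }.

Lemma sesI A B C f g : @ghom A B f -> @ghom B C g ->
  row_free f -> row_full g -> (f == kermx g)%MS -> ses f g.
Proof.
move=> hf hg ff /row_fullP[s sg] /eqmxP kg; split=> //.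
have fg : f *m g = 0 by apply/sub_kermxP; rewrite -kg.
have /submxP[r Er] : (1%:M - g *m s <= f)%MS.
  by rewrite kg; apply/sub_kermxP; rewrite mulmxBl mul1mx -mulmxA sg mulmx1 subrr.
exists r, s; split=> //; last by rewrite -Er subrK.
  apply: (row_free_inj ff); rewrite /= -mulmxA -Er mulmxBr mulmx1 mulmxA fg.
  by rewrite mul0mx subr0 mul1mx.
apply: (row_free_inj ff); rewrite /= -mulmxA -Er mulmxBr mulmx1 mulmxA sg.
by rewrite !mul1mx mul0mx subrr.
Qed.

End StableHoms.

(** * Dimensions of spaces of homs in exact sequences *)

Section Counting.
Variables (k : fieldType) (gT : finGroupType) (G : {group gT}).
Implicit Types A B C N X Y Z Q I : gmod k G.

Section Ses.
Variables (A B C : gmod k G) (f : 'M[k]_(gdim A, gdim B)).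
Variable g : 'M[k]_(gdim B, gdim C).
Hypothesis fg : ses f g.

Lemma ses_comp0 : f *m g = 0. Proof. by case: fg => _ _ [r [s []]]. Qed.

Lemma ses_mono n (u v : 'M_(n, _)) : u *m f = v *m f -> u = v.
Proof.
case: fg => _ _ [r [s [fr _ _ _ _]]] /(congr1 (mulmx^~ r)) /=.
by rewrite -!mulmxA fr !mulmx1.
Qed.

Lemma ses_epi n (u v : 'M_(_, n)) : g *m u = g *m v -> u = v.
Proof.
case: fg => _ _ [r [s [_ sg _ _ _]]] /(congr1 (mulmx s)) /=.
by rewrite !mulmxA sg !mul1mx.
Qed.

Lemma ses_kerP X (u : 'M[k]_(gdim X, gdim B)) : ghom u -> u *m g = 0 ->
  exists2 v : 'M[k]_(gdim X, gdim A), ghom v & u = v *m f.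
Proof.
case: (fg) => hf _ [r [s [_ _ _ _ rs]]] hu ug.
have E : u = u *m r *m f.
  by rewrite -{1}[u]mulmx1 -rs mulmxDr !mulmxA ug mul0mx addr0.
exists (u *m r) => // x Gx; apply: ses_mono.
by rewrite -[LHS]mulmxA -E hu // -[RHS]mulmxA hf // [RHS]mulmxA -E.
Qed.

Lemma ses_cokerP X (u : 'M[k]_(gdim B, gdim X)) : ghom u -> f *m u = 0 ->
  exists2 v : 'M[k]_(gdim C, gdim X), ghom v & u = g *m v.
Proof.
case: (fg) => _ hg [r [s [_ _ _ _ rs]]] hu fu.
have E : u = g *m (s *m u).
  by rewrite -{1}[u]mul1mx -rs mulmxDl -!mulmxA fu mulmx0 add0r.
exists (s *m u) => // x Gx; apply: ses_epi.
by rewrite [LHS]mulmxA -hg // -[LHS]mulmxA -E hu // [RHS]mulmxA -E.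
Qed.

Lemma relproj_lift X (u : 'M[k]_(gdim X, gdim C)) : relproj X -> ghom u ->
  exists2 v : 'M[k]_(gdim X, gdim B), ghom v & v *m g = u.
Proof.
case: (fg) => _ hg [r [s [_ sg _ _ _]]] [th th1] hu.
exists (trc (th *m u *m s)); first exact: trc_hom.
by rewrite trc_mulr // -mulmxA sg mulmx1 -(trc_mulr _ hu) th1 mul1mx.
Qed.

Lemma relproj_ext X (u : 'M[k]_(gdim A, gdim X)) : relproj X -> ghom u ->
  exists2 v : 'M[k]_(gdim B, gdim X), ghom v & f *m v = u.
Proof.
case: (fg) => hf _ [r [s [fr _ _ _ _]]] [th th1] hu.
exists (trc (r *m u *m th)); first exact: trc_hom.
by rewrite trc_mull // !mulmxA fr mul1mx -(trc_mull _ hu) th1 mulmx1.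
Qed.

Lemma hdim_img X :
  (hdim X B = hdim X A + \dim (linfun (mulmxr g) @: homG X B))%N.
Proof.
case: (fg) => hf _ _.
apply: (@dim_ker_img _ _ _ _ _ _ (mulmxr f) (mulmxr g)) => /=.
- by move=> u /memh hu; apply/memh/(ghom_mul hu).
- by move=> u _ uf; apply: ses_mono; rewrite uf mul0mx.
- by move=> u _; rewrite -mulmxA ses_comp0 mulmx0.
- by move=> v /memh hv /(ses_kerP hv)[u hu ->]; exists u => //; apply/memh.
Qed.

Lemma img_sub_hom X : (linfun (mulmxr g) @: homG X B <= homG X C)%VS.
Proof.
case: (fg) => _ hg _; apply/subvP=> _ /memv_imgP[u /memh hu ->].
by rewrite lfunE; apply/memh/(ghom_mul hu).
Qed.

Lemma trc_sub_img X :
  (limg (linfun (@trc _ _ _ X C)) <= linfun (mulmxr g) @: homG X B)%VS.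
Proof.
case: (fg) => _ hg [r [s [_ sg _ _ _]]].
apply/subvP=> _ /trcP[w ->]; apply/memv_imgP; exists (trc (w *m s)).
  exact/memh/trc_hom.
by rewrite lfunE /= trc_mulr // -mulmxA sg mulmx1.
Qed.

Lemma hdim_left_exact X : (hdim X B <= hdim X A + hdim X C)%N.
Proof. by rewrite hdim_img leq_add2l; apply/dimvS/img_sub_hom. Qed.

Lemma hdim_right_relproj X : relproj X -> (hdim X B = hdim X A + hdim X C)%N.
Proof.
move=> pX; rewrite hdim_img; congr (_ + \dim _)%N; apply: subv_anti.
rewrite img_sub_hom; apply/subvP=> w /memh /(relproj_lift pX)[v hv <-].
by apply/memv_imgP; exists v; rewrite ?lfunE //; apply/memh.
Qed.

(** A map X -> C that lifts to the projective module B factors through it and is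
    therefore a trace; conversely every trace lifts. *)
Lemma hdim_relproj_mid X : relproj B -> (hdim X B = hdim X A + tdim X C)%N.
Proof.
case: (fg) => _ hg _ [th th1]; rewrite hdim_img; congr (_ + \dim _)%N.
apply: subv_anti; rewrite trc_sub_img andbT.
apply/subvP=> _ /memv_imgP[v /memh hv ->]; apply/trcP; exists (v *m th *m g).
by rewrite lfunE /= -(trc_mulr _ hg) -(trc_mull _ hv) th1 mulmx1.
Qed.

Lemma hdim_relproj_midl X : relproj B -> (hdim B X = hdim C X + tdim A X)%N.
Proof.
case: (fg) => hf hg [r [s [fr _ _ _ _]]] [th th1].
apply: (@dim_exact _ _ _ _ _ _ _ (mulmx g) (mulmx f)) => /=.
- by move=> u /memh hu; apply/memh/(ghom_mul hg).
- by move=> u _ uf; apply: ses_epi; rewrite uf mulmx0.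
- by move=> u _; rewrite mulmxA ses_comp0 mul0mx.
- by move=> v /memh hv /(ses_cokerP hv)[u hu ->]; exists u => //; apply/memh.
- move=> v /memh hv; apply/trcP; exists (f *m th *m v).
  by rewrite -(trc_mulr _ hv) -(trc_mull _ hf) th1 mulmx1.
- move=> _ /trcP[w ->].
  exists (trc (r *m w)); first exact/memh/trc_hom.
  by rewrite trc_mull // mulmxA fr mul1mx.
Qed.

(** The cokernel of Hom(X, B) -> Hom(X, C) is a quotient of the stable homs from
    X to C, since traces lift to B. *)
Lemma hdim_cokernel_bound X : (hdim X A + hdim X C <= hdim X B + sdim X C)%N.
Proof.
have := dimvS (trc_sub_img X); rewrite -/(tdim X C) hdim_img.
have := tdim_le X C; rewrite /sdim; move: (hdim X C) (tdim X C) (\dim _) (hdim X A).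
by move=> h t i a; lia.
Qed.

End Ses.

Section TwoSes.
Variables (Z Q A N I C : gmod k G).
Variables (i : 'M[k]_(gdim Z, gdim Q)) (p : 'M[k]_(gdim Q, gdim A)).
Variables (j : 'M[k]_(gdim N, gdim I)) (q : 'M[k]_(gdim I, gdim C)).
Hypotheses (ip : ses i p) (jq : ses j q) (projQ : relproj Q).

(** The maps Q -> I that carry Z into N. Restricting to Z gives a map Z -> N, and
    passing to the quotients a map A -> C; computing the dimension through
    either one compares the homs from Z to N with those from A to C. *)
Definition chain_homs : {vspace 'M[k]_(gdim Q, gdim I)} :=
  (homG Q I :&: lker (linfun (mulmxr q \o mulmx i)))%VS.

Lemma mem_chain_homs u :
  (u \in chain_homs) <-> (ghom u /\ i *m u *m q = 0).
Proof.
rewrite memv_cap memv_ker lfunE /=.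
by split=> [/andP[/memh ? /eqP]|[hu /eqP->]]; rewrite ?andbT //; apply/memh.
Qed.

Lemma dim_chain_homs_restr :
  exists2 l : {linear 'M[k]_(gdim Q, gdim I) -> 'M[k]_(gdim Z, gdim N)},
    (forall u, u \in chain_homs -> ghom (l u) /\ i *m u = l u *m j) &
    \dim chain_homs = (hdim A I + \dim (linfun l @: chain_homs))%N.
Proof.
case: (ip) (jq) => hi hp _ [hj hq [r [s [jr _ _ _ rs]]]].
have E u : i *m u *m q = 0 -> i *m u = i *m u *m r *m j.
  by move=> u0; rewrite -[LHS]mulmx1 -rs mulmxDr !mulmxA u0 mul0mx addr0.
exists (mulmxr r \o mulmx i) => [u|].
  move=> /mem_chain_homs[hu u0]; split; last exact: E.
  move=> x Gx; apply: (ses_mono jq); rewrite /= -[LHS]mulmxA -(E u u0).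
  by rewrite -[RHS]mulmxA hj // [RHS]mulmxA -(E u u0) (ghom_mul hi hu).
apply: (@dim_ker_img _ _ _ _ _ _ (mulmx p) (mulmxr r \o mulmx i)) => /=.
- move=> u /memh hu; apply/mem_chain_homs; split; first exact: (ghom_mul hp).
  by rewrite mulmxA (ses_comp0 ip) !mul0mx.
- by move=> u _ pu; apply: (ses_epi ip); rewrite pu mulmx0.
- by move=> u _; rewrite !mulmxA (ses_comp0 ip) !mul0mx.
- move=> u /mem_chain_homs[hu u0] ur0.
  have /(ses_cokerP ip hu)[v hv ->] : i *m u = 0 by rewrite (E u u0) ur0 mul0mx.
  by exists v => //; apply/memh.
Qed.

Lemma dim_chain_homs : (\dim chain_homs = hdim Q N + hdim A C)%N.
Proof.
case: (ip) (jq) => hi hp [r [s [_ sp _ _ rs]]] [hj hq _].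
have E u : i *m u *m q = 0 -> u *m q = p *m (s *m u *m q).
  move=> u0; rewrite -[LHS]mul1mx -rs mulmxDl.
  by rewrite -mulmxA [i *m _]mulmxA u0 mulmx0 add0r !mulmxA.
apply: (@dim_exact _ _ _ _ _ _ _ (mulmxr j) (mulmxr q \o mulmx s)) => /=.
- move=> u /memh hu; apply/mem_chain_homs; split; first exact: (ghom_mul hu).
  by rewrite -!mulmxA (ses_comp0 jq) !mulmx0.
- by move=> u _ uj; apply: (ses_mono jq); rewrite uj mul0mx.
- by move=> u _; rewrite -!mulmxA (ses_comp0 jq) !mulmx0.
- move=> u /mem_chain_homs[hu u0] su0.
  have /(ses_kerP jq hu)[v hv ->] : u *m q = 0 by rewrite (E u u0) su0 mulmx0.
  by exists v => //; apply/memh.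
- move=> u /mem_chain_homs[hu u0]; apply/memh => x Gx.
  apply: (ses_epi ip); rewrite [LHS]mulmxA -hp // -[LHS]mulmxA -(E u u0).
  by rewrite (ghom_mul hu hq) // [RHS]mulmxA -(E u u0).
- move=> w /memh hw; have [u hu uE] := relproj_lift jq projQ (ghom_mul hp hw).
  exists u; last by rewrite -mulmxA uE mulmxA sp mul1mx.
  by apply/mem_chain_homs; split; rewrite // -mulmxA uE mulmxA (ses_comp0 ip) mul0mx.
Qed.

(** The stable homs from Z to N form Ext^1(A, N), and the connecting map embeds
    the cokernel of Hom(A, I) -> Hom(A, C) in it. *)
Lemma hdim_connecting_bound :
  (hdim A N + hdim A C <= hdim A I + sdim Z N)%N.
Proof.
have [l lP] := dim_chain_homs_restr.
have : (linfun l @: chain_homs <= homG Z N)%VS.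
  apply/subvP=> _ /memv_imgP[u /lP[hu _] ->]; rewrite lfunE; exact/memh.
move/dimvS; rewrite dim_chain_homs (hdim_relproj_midl ip) //.
have := tdim_le Z N; rewrite /sdim /hdim.
move: (tdim Z N) (\dim (homG Z N)) (\dim (homG A N)) => a b c.
by move: (\dim (homG A C)) (\dim (homG A I)) (\dim _) => d e f; lia.
Qed.

(** Dimension shifting: passing from A to its syzygy Z is the same as passing from
    N to its cosyzygy C. *)
Lemma sdim_shift : relproj I -> sdim Z N = sdim A C.
Proof.
move=> projI; have [l lP] := dim_chain_homs_restr.
have -> : (linfun l @: chain_homs = homG Z N)%VS.
  apply/vspaceP=> w; apply/memv_imgP/memh => [[u /lP[hu _] ->]|hw].
    by rewrite lfunE.
  case: (jq) => hj _ _; have [u hu uE] := relproj_ext ip projI (ghom_mul hw hj).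
  have cu : u \in chain_homs.
    by apply/mem_chain_homs; rewrite uE -mulmxA (ses_comp0 jq) mulmx0.
  exists u => //; rewrite lfunE; apply: (ses_mono jq).
  by case: (lP u cu) => _ <-; rewrite uE.
rewrite dim_chain_homs (hdim_relproj_midl ip) // (hdim_relproj_mid jq) //.
have := tdim_le Z N; have := tdim_le A C; rewrite /sdim /hdim.
move: (tdim Z N) (\dim (homG Z N)) (\dim (homG A N)) => a b c.
by move: (\dim (homG A C)) (\dim (homG A I)) (tdim A C) => d e f; lia.
Qed.

End TwoSes.

End Counting.

(** * Duals, internal homs and the triangle identity *)

Section Constructions.
Variables (k : fieldType) (gT : finGroupType) (G : {group gT}).
Implicit Types A B C N X Y Z Q I : gmod k G.

Lemma dual_mx_repr A : mx_repr G (fun x => (A x^-1%g)^T).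
Proof.
split=> [|x y Gx Gy]; first by rewrite invg1 repr_mx1 trmx1.
by rewrite invMg repr_mxM ?groupV // trmx_mul.
Qed.
Definition gdual A := GMod (MxRepresentation (dual_mx_repr A)).

Lemma dual_comp A B (f : 'M[k]_(gdim A, gdim B)) :
  ghom f -> @ghom _ _ _ (gdual B) (gdual A) f^T.
Proof. by move=> hf x Gx; rewrite /= -!trmx_mul hf ?groupV. Qed.

Lemma dual_compK A B (f : 'M[k]_(gdim B, gdim A)) :
  @ghom _ _ _ (gdual B) (gdual A) f -> @ghom _ _ _ A B f^T.
Proof.
move=> hf x Gx; have /(congr1 trmx) := hf _ (groupVr Gx).
by rewrite /= invgK !trmx_mul !trmxK.
Qed.

Lemma gdualK A : gdual (gdual A) = A.
Proof.
case: A => a [A hA]; rewrite /gdual /=; congr GMod.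
have E : (fun x => ((A (x^-1)^-1%g)^T)^T) = A.
  by apply/funext => x; rewrite trmxK invgK.
move: (dual_mx_repr _) => /=; rewrite E => hA'; congr MxRepresentation.
exact: Prop_irrelevance.
Qed.

Lemma relproj_dual A : relproj A -> relproj (gdual A).
Proof.
move=> [th th1]; exists th^T; rewrite -[1%:M]trmx1 -th1 /trc /=.
rewrite [RHS](raddf_sum (@trmx _ _ _)); apply: eq_bigr => x _ /=.
by rewrite invgK !trmx_mul mulmxA.
Qed.

Lemma ses_dual A B C f g : @ses _ _ _ A B C f g ->
  @ses _ _ _ (gdual C) (gdual B) (gdual A) g^T f^T.
Proof.
case=> hf hg [r [s [fr sg fg sr rs]]]; split; [exact: dual_comp..|].
exists s^T, r^T; rewrite -!trmx_mul fr sg fg sr !trmx0 !trmx1; split=> //.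
by rewrite addrC -linearD /= rs trmx1.
Qed.

Lemma trc_dual A B (f : 'M[k]_(gdim A, gdim B)) :
  @trc _ _ _ (gdual B) (gdual A) f^T = (trc f)^T.
Proof.
rewrite /trc /= [RHS](raddf_sum (@trmx _ _ _)); apply: eq_bigr => x _ /=.
by rewrite invgK !trmx_mul mulmxA.
Qed.

Lemma hdim_dual A B : hdim A B = hdim (gdual B) (gdual A).
Proof.
apply: (@eq_dim_bij _ _ _ _ _ (@trmx k (gdim A) (gdim B))).
- by move=> u /memh/dual_comp hu; exact/(@memh _ _ _ (gdual B) (gdual A)).
- by move=> u _ u0; rewrite -[u]trmxK u0 trmx0.
- move=> v /(@memh _ _ _ (gdual B) (gdual A))/dual_compK hv.
  by exists v^T; [exact/memh | exact/esym/trmxK].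
Qed.

Lemma tdim_dual A B : tdim A B = tdim (gdual B) (gdual A).
Proof.
apply: (@eq_dim_bij _ _ _ _ _ (@trmx k (gdim A) (gdim B))).
- move=> _ /trcP[u ->]; rewrite /= -trc_dual.
  by apply/(@trcP _ _ _ (gdual B) (gdual A)); exists u^T.
- by move=> u _ u0; rewrite -[u]trmxK u0 trmx0.
- move=> _ /(@trcP _ _ _ (gdual B) (gdual A))[u ->]; exists (@trc _ _ _ A B u^T).
    by apply/trcP; exists u^T.
  by rewrite /= -trc_dual; exact: (congr1 (@trc _ _ _ (gdual B) (gdual A)) (esym (trmxK u))).
Qed.

Lemma sdim_dual A B : sdim A B = sdim (gdual B) (gdual A).
Proof. by rewrite /sdim hdim_dual tdim_dual. Qed.

Lemma eq_mxvec_mul m n p (M M' : 'M[k]_(m * n, p)) :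
  (forall u : 'M_(m, n), mxvec u *m M = mxvec u *m M') -> M = M'.
Proof.
move=> E; apply/row_matrixP => i; rewrite !rowE.
by rewrite -[delta_mx _ _](@vec_mxK k m n).
Qed.

Lemma inner_mx_repr A B :
  mx_repr G (fun x => lin_mx (mulmx (A x^-1%g) \o mulmxr (B x))).
Proof.
split=> [|x y Gx Gy]; apply: eq_mxvec_mul => u.
  by rewrite mul_vec_lin /= invg1 !repr_mx1 mul1mx !mulmx1.
rewrite mulmxA !mul_vec_lin /= invMg !repr_mxM ?groupV //.
by rewrite !mulmxA.
Qed.
(** Hom_k(A, B) with its diagonal action, flattened to row vectors. *)
Definition inner A B := GMod (MxRepresentation (inner_mx_repr A B)).

Definition post B X Y (f : 'M[k]_(gdim X, gdim Y)) :
    'M[k]_(gdim (inner B X), gdim (inner B Y)) := lin_mx (mulmxr f).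

Lemma post_hom B X Y (f : 'M[k]_(gdim X, gdim Y)) :
  ghom f -> ghom (@post B X Y f).
Proof.
move=> hf x Gx; apply: eq_mxvec_mul => u.
by rewrite !mulmxA !mul_vec_lin /= -!mulmxA hf.
Qed.

Lemma ses_inner D A B C f g : @ses _ _ _ A B C f g ->
  ses (@post D A B f) (@post D B C g).
Proof.
case=> hf hg [r [s [fr sg fg sr rs]]]; split; [exact: post_hom..|].
exists (@post D B A r), (@post D C B s); split; apply: eq_mxvec_mul => u;
  rewrite ?mulmxDr ?mulmxA !mul_vec_lin /= -?mulmxA ?fr ?sg ?fg ?sr;
  rewrite ?mulmx1 ?mulmx0 ?linear0 //.
by rewrite -linearD /= -mulmxDr rs mulmx1.
Qed.

Lemma relproj_innerr B A : relproj A -> relproj (inner B A).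
Proof.
move=> [th th1]; exists (lin_mx (mulmxr th)); apply: eq_mxvec_mul => u.
rewrite /trc mulmx_sumr mulmx1 -[u in RHS]mulmx1 -th1 /trc mulmx_sumr linear_sum.
apply: eq_bigr => x Gx; rewrite /= !mulmxA !mul_vec_lin /= invgK; congr mxvec.
by rewrite !mulmxA -repr_mxM ?groupV // mulVg repr_mx1 mul1mx.
Qed.

Lemma relproj_innerl A B : relproj A -> relproj (inner A B).
Proof.
move=> [th th1]; exists (lin_mx (mulmx th)); apply: eq_mxvec_mul => u.
rewrite /trc mulmx_sumr mulmx1 -[u in RHS]mul1mx -th1 /trc mulmx_suml linear_sum.
apply: eq_bigr => x Gx; rewrite /= !mulmxA !mul_vec_lin /= invgK; congr mxvec.
by rewrite -!mulmxA -repr_mxM ?groupV // mulVg repr_mx1 mulmx1.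
Qed.

Definition conj_act A B x (f : 'M[k]_(gdim A, gdim B)) := A x^-1%g *m f *m B x.

Lemma homP_conj A B f :
  @ghom _ _ _ A B f <-> {in G, forall x, conj_act x f = f}.
Proof.
split=> hf x Gx.
  by rewrite /conj_act hf ?groupV // -mulmxA -repr_mxM ?groupV // mulVg repr_mx1 mulmx1.
rewrite -{1}(hf x Gx) /conj_act !mulmxA -repr_mxM ?groupV //.
by rewrite mulgV repr_mx1 mul1mx.
Qed.

(** Stable homs depend only on the space of linear maps with its conjugation
    action, so an equivariant retract of that space has fewer of them. *)
Lemma sdim_retract A B X Y
    (l : {linear 'M[k]_(gdim A, gdim B) -> 'M[k]_(gdim X, gdim Y)})
    (r : {linear 'M[k]_(gdim X, gdim Y) -> 'M[k]_(gdim A, gdim B)}) :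
    (forall f, r (l f) = f) ->
    {in G, forall x f, l (conj_act x f) = conj_act x (l f)} ->
    {in G, forall x f, r (conj_act x f) = conj_act x (r f)} ->
  (sdim A B <= sdim X Y)%N.
Proof.
move=> lK lG rG.
have l_trc f : l (trc f) = trc (l f).
  by rewrite /trc linear_sum; apply: eq_bigr => x Gx; apply: lG.
have r_trc f : r (trc f) = trc (r f).
  by rewrite /trc linear_sum; apply: eq_bigr => x Gx; apply: rG.
have Eh : (linfun r @: homG X Y = homG A B)%VS.
  apply/vspaceP=> f; apply/memv_imgP/memh => [[g /memh/homP_conj hg ->]|/homP_conj hf].
    by apply/homP_conj=> x Gx; rewrite lfunE /= -rG // hg.
  exists (l f); last by rewrite lfunE /= lK.
  by apply/memh/homP_conj=> x Gx; rewrite -lG // hf.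
have Et : (linfun r @: limg (linfun (@trc _ _ _ X Y)) = limg (linfun (@trc _ _ _ A B)))%VS.
  apply/vspaceP=> f; apply/memv_imgP/trcP => [[_ /trcP[g ->] ->]|[g ->]].
    by rewrite lfunE /= r_trc; exists (r g).
  by exists (trc (l g)); [apply/trcP; exists (l g) | rewrite lfunE /= r_trc lK].
rewrite /sdim /hdim /tdim.
rewrite -(limg_ker_dim (linfun r) (homG X Y)) Eh.
rewrite -(limg_ker_dim (linfun r) (limg (linfun (@trc _ _ _ X Y)))) Et.
have : (limg (linfun (@trc _ _ _ X Y)) :&: lker (linfun r) <=
        homG X Y :&: lker (linfun r))%VS.
  by apply: capvS => //; apply/subvP=> _ /trcP[f ->]; apply/memh/trc_hom.
move/dimvS; have := tdim_le A B; rewrite /hdim /tdim.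
move: (\dim _) (\dim _) (\dim _) (\dim _) => c1 c2 c3 c4; lia.
Qed.

Section Triangle.
Variables A C : gmod k G.
Local Notation a := (gdim A).
Local Notation c := (gdim C).
Local Notation T := (inner (gdual A) (inner (gdual A) C)).

(** A map f : A^* -> C gives A -> Hom(A^*, Hom(A^*, C)), sending v to
    ph, ps |-> ph(v) f(ps). *)
Definition coev_row (f : 'M[k]_(a, c)) (v : 'rV[k]_a) : 'rV[k]_(a * (a * c)) :=
  mxvec (v^T *m mxvec f).

Lemma coev_row_is_linear f : linear (coev_row f).
Proof.
by move=> z u v; rewrite /coev_row linearP mulmxDl linearD -scalemxAl linearZ.
Qed.
HB.instance Definition _ f := GRing.isLinear.Build k _ _ *:%R (coev_row f)
  (coev_row_is_linear f).

Definition coev (f : 'M[k]_(a, c)) : 'M[k]_(a, a * (a * c)) := lin1_mx (coev_row f).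

Lemma coevE f v : v *m coev f = mxvec (v^T *m mxvec f).
Proof. exact: mul_rV_lin1. Qed.

Lemma coev_is_linear : linear coev.
Proof.
move=> z f g; apply/row_matrixP => i; rewrite !rowE mulmxDr -scalemxAr !coevE.
by rewrite linearP mulmxDr linearD -scalemxAr linearZ.
Qed.
HB.instance Definition _ := GRing.isLinear.Build k _ _ *:%R coev coev_is_linear.

Definition eval2 (F : 'M[k]_(a, a * (a * c))) (ph : 'rV[k]_a) (v : 'rV[k]_a) :
    'M[k]_(a, c) :=
  vec_mx (ph *m vec_mx (v *m F)).

(** The left inverse of coev: contract the second functional with the argument,
    sending F to ph |-> sum of the F(e_j)(ph, e_j^* ) over a basis (e_j). *)
Definition contr (F : 'M[k]_(a, a * (a * c))) : 'M[k]_(a, c) :=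
  \matrix_i \sum_j 'e_j *m eval2 F ('e_i) ('e_j).

Lemma eval2_is_linear F ph : linear (eval2 F ph).
Proof.
move=> z u v; rewrite /eval2 mulmxDl -scalemxAl linearP mulmxDr linearD.
by rewrite -scalemxAr linearZ.
Qed.
HB.instance Definition _ F ph := GRing.isLinear.Build k _ _ *:%R (eval2 F ph)
  (eval2_is_linear F ph).

Lemma contrE F ph :
  ph *m contr F = \sum_j 'e_j *m eval2 F ph ('e_j).
Proof.
rewrite {1}[ph]row_sum_delta mulmx_suml.
under eq_bigr => i _ do rewrite -scalemxAl -rowE rowK scaler_sumr.
rewrite exchange_big; apply: eq_bigr => j _ /=.
rewrite [X in _ = _ *m eval2 _ X _]row_sum_delta /eval2 mulmx_suml linear_sum mulmx_sumr.
by apply: eq_bigr => i _; rewrite -scalemxAl linearZ /= -scalemxAr.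
Qed.

Lemma contr_is_linear : linear contr.
Proof.
move=> z F F'; apply/row_matrixP => i; rewrite !rowE mulmxDr -scalemxAr !contrE.
rewrite scaler_sumr -big_split; apply: eq_bigr => j _ /=.
by rewrite /eval2 mulmxDr -scalemxAr linearP mulmxDr linearD mulmxDr -scalemxAr
  linearZ /= scalemxAr.
Qed.
HB.instance Definition _ := GRing.isLinear.Build k _ _ *:%R contr contr_is_linear.

Lemma coevK f : contr (coev f) = f.
Proof.
apply/row_matrixP => i; rewrite !rowE contrE.
move: ('e_i) => ph; rewrite [in RHS](row_sum_delta ph) mulmx_suml.
apply: eq_bigr => j _; rewrite /eval2 coevE mxvecK mulmxA [ph *m _]mx11_scalar.
rewrite mul_scalar_mx linearZ /= mxvecK -scalemxAr scalemxAl; congr (_ *: _ *m _).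
by rewrite !mxE (bigD1 j) //= big1 ?addr0 => [|l /negPf jl]; 
  rewrite !mxE ?jl ?mulr0 // !eqxx mulr1.
Qed.

Lemma coev_conj x f : x \in G ->
  coev (@conj_act (gdual A) C x f) = @conj_act A T x (coev f).
Proof.
move=> Gx; apply/row_matrixP => i; rewrite !rowE /conj_act !mulmxA !coevE.
rewrite !mul_vec_lin /= !invgK trmx_mul mulmxA; congr mxvec.
rewrite !mulmxA -trmx_mul -repr_mxM ?groupV // mulVg repr_mx1 trmx1 mul1mx.
by rewrite -[RHS]mulmxA mul_vec_lin /= mulmxA.
Qed.

Local Notation e j := ('e_j : 'rV[k]_a).

(** The canonical tensor of the sum of e_j (x) e_j^* does not depend on the basis. *)
Lemma sum_dual_basis (Y Z : 'M[k]_a) (N : {linear 'rV[k]_a -> 'M[k]_(a, c)}) :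
    Y^T *m Z = 1%:M ->
  \sum_j (e j *m (Z *m N (e j *m Y))) = \sum_j (e j *m N (e j)).
Proof.
move=> YZ; under eq_bigr => j _.
  rewrite ['e_j *m Y]row_sum_delta linear_sum !mulmx_sumr.
  over.
rewrite exchange_big; apply: eq_bigr => i _ /=.
have -> : e i *m N (e i) = e i *m Y^T *m (Z *m N (e i)).
  by rewrite -mulmxA [Y^T *m _]mulmxA YZ mul1mx.
rewrite [X in _ = X *m _]row_sum_delta mulmx_suml; apply: eq_bigr => j _.
by rewrite linearZ /= -!scalemxAr -scalemxAl -!rowE !mxE.
Qed.

Lemma eval2_conj x F ph v : x \in G ->
  eval2 (@conj_act A T x F) ph v =
  (A x)^T *m eval2 F (ph *m (A x)^T) (v *m A x^-1%g) *m C x.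
Proof.
move=> Gx; rewrite /eval2 /conj_act !mulmxA.
rewrite -[v *m _ *m F]vec_mxK mul_vec_lin /= mxvecK invgK !mulmxA.
by rewrite -[X in vec_mx (X *m _)]vec_mxK mul_vec_lin /= !mxvecK ?mulmxA.
Qed.

Lemma contr_conj x F : x \in G ->
  contr (@conj_act A T x F) = @conj_act (gdual A) C x (contr F).
Proof.
move=> Gx; apply/row_matrixP => i; rewrite !rowE /conj_act !mulmxA contrE.
move: ('e_i) => ph; rewrite contrE.
under eq_bigr => j _ do rewrite eval2_conj // mulmxA.
rewrite -mulmx_suml /= invgK; congr (_ *m _); apply: sum_dual_basis.
by rewrite -trmx_mul -repr_mxM ?groupV // mulgV repr_mx1 trmx1.
Qed.

(** A^* is a direct summand of A^* (x) A (x) A^* in every characteristic, by the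
    triangle identity of duality. This is what makes a module and its dual
    have the same complexity. *)
Lemma sdim_triangle :
  (sdim (gdual A) C <= sdim A T)%N.
Proof.
apply: (@sdim_retract (gdual A) C A T coev contr); first exact: coevK.
  by move=> x Gx f; apply: coev_conj.
by move=> x Gx f; apply: contr_conj.
Qed.

End Triangle.
End Constructions.

(** * Permutation modules, projective modules, submodules *)

Section Permutation.
Variables (k : fieldType) (gT : finGroupType) (G : {group gT}).
Variables (T : finType) (act : T -> gT -> T).
Hypothesis act1 : forall t, act t 1%g = t.
Hypothesis actM : {in G &, forall x y t, act t (x * y)%g = act (act t x) y}.

Definition perm_act_mx x : 'M[k]_#|T| :=
  \matrix_(i, j) (enum_val j == act (enum_val i) x)%:R.

Lemma row_perm_act n (B : 'M[k]_(#|T|, n)) t x :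
  row (enum_rank t) (perm_act_mx x *m B) = row (enum_rank (act t x)) B.
Proof.
apply/rowP => j; rewrite !mxE (bigD1 (enum_rank (act t x))) //= big1 => [|i ne_i].
  by rewrite !mxE !enum_rankK eqxx mul1r addr0.
rewrite !mxE enum_rankK [_ == _](_ : _ = false) ?mul0r //.
by apply/negbTE; apply: contra ne_i => /eqP <-; rewrite enum_valK.
Qed.

Lemma eq_row_enum n (A B : 'M[k]_(#|T|, n)) :
  (forall t, row (enum_rank t) A = row (enum_rank t) B) -> A = B.
Proof. by move=> E; apply/row_matrixP => i; rewrite -(enum_valK i). Qed.

Lemma perm_act_mx_repr : mx_repr G perm_act_mx.
Proof.
split=> [|x y Gx Gy]; apply: eq_row_enum => t.
  by rewrite -[perm_act_mx 1]mulmx1 row_perm_act act1.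
rewrite row_perm_act -[perm_act_mx _]mulmx1 row_perm_act actM //.
by rewrite -(row_perm_act _ _ y) mulmx1.
Qed.
Definition permmod : gmod k G := GMod (MxRepresentation perm_act_mx_repr).

Lemma permmod_homP (X : gmod k G) (f : 'M_(#|T|, gdim X)) :
  @ghom _ _ _ permmod X f <->
  {in G, forall x t, row (enum_rank (act t x)) f = row (enum_rank t) f *m X x}.
Proof.
split=> [hf x Gx t|hf x Gx].
  by rewrite -row_perm_act -row_mul; congr row; exact: hf.
by apply: eq_row_enum => t; rewrite row_perm_act hf // row_mul.
Qed.

Lemma permmod_orthogonal x : x \in G -> (permmod x)^T = permmod x^-1%g.
Proof.
move=> Gx; apply/matrixP => i j; rewrite !mxE; congr (nat_of_bool _)%:R.
apply/eqP/eqP => ->; rewrite -actM ?groupV //; first by rewrite mulgV act1.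
by rewrite mulVg act1.
Qed.

Lemma permmod_basis t x :
  ('e_(enum_rank t) : 'rV[k]_#|T|) *m permmod x = 'e_(enum_rank (act t x)).
Proof. by rewrite -rowE -[permmod x]mulmx1 row_perm_act row1. Qed.

End Permutation.

Section Free.
Variables (k : fieldType) (gT : finGroupType) (G : {group gT}).
Implicit Types A B C N X Y Z Q I : gmod k G.

Definition reg_act (t : subg_of G) (x : gT) := (t * subg G x)%g.

Lemma reg_act1 t : reg_act t 1%g = t.
Proof. by rewrite /reg_act morph1 mulg1. Qed.

Lemma reg_actM : {in G &, forall x y t, reg_act t (x * y)%g = reg_act (reg_act t x) y}.
Proof. by move=> x y Gx Gy t; rewrite /reg_act morphM ?mulgA. Qed.

Definition regmod : gmod k G := permmod k reg_act1 reg_actM.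

(** G acts regularly, so the conjugates of the projection onto one basis line add
    up to the identity. *)
Lemma relproj_reg : relproj regmod.
Proof.
pose e := enum_rank (1%g : subg_of G).
exists (delta_mx e e); apply: eq_row_enum => t; rewrite /trc linear_sum /=.
have E x : x \in G -> row (enum_rank t) (regmod x^-1%g *m delta_mx e e *m regmod x) =
    if subg G x == t then row (enum_rank t) 1%:M else 0.
  move=> Gx; rewrite -mulmxA (row_perm_act reg_act).
  rewrite -(mul_delta_mx (0 : 'I_1)) -mulmxA row_mul.
  have -> : row (enum_rank (reg_act t x^-1)) (delta_mx e (0 : 'I_1)) =
      ((subg G x == t)%:R)%:M :> 'M[k]_1.
    apply/rowP => i; rewrite !mxE !ord1 /e (inj_eq enum_rank_inj) /reg_act.
    by rewrite morphV // -eq_mulgV1 eq_sym eqxx andbT.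
  case: eqP => [<-|_]; last by rewrite mul_scalar_mx scale0r.
  rewrite mul1mx -rowE -[repr_mx _ x]mulmx1 (row_perm_act reg_act).
  by rewrite /reg_act mul1g.
rewrite (bigD1 (sgval t)) ?subgP //= E ?subgP // sgvalK eqxx big1 ?addr0 //.
move=> x /andP[Gx ne_xt]; rewrite E // ifN //; apply: contra ne_xt => /eqP <-.
by rewrite subgK.
Qed.

Lemma relproj_retract A B (h : 'M[k]_(gdim A, gdim B)) g :
  ghom h -> @ghom _ _ _ B A g -> h *m g = 1%:M -> relproj B -> relproj A.
Proof.
move=> hh hg hg1 [th th1]; exists (h *m th *m g).
by rewrite -(trc_mulr _ hg) -(trc_mull _ hh) th1 mulmx1.
Qed.

(** Hom_k(kG, A), a projective module that both maps onto A and contains A. *)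
Definition induced A := inner regmod A.

Lemma relproj_induced A : relproj (induced A).
Proof. exact: relproj_innerl relproj_reg. Qed.

Local Notation ones := (const_mx 1 : 'M[k]_(1, #|{: subg_of G}|)).

Lemma ones_reg x : x \in G -> ones *m regmod x = ones.
Proof.
move=> Gx; apply/rowP => j; rewrite !mxE.
rewrite (bigD1 (enum_rank (reg_act (enum_val j) x^-1%g))) //=.
rewrite big1 => [|i ne_i].
  by rewrite !mxE enum_rankK -reg_actM ?groupV // mulVg reg_act1 eqxx mulr1 addr0.
rewrite !mxE [_ == _](_ : _ = false) ?mulr0 //; apply: contraNF ne_i => /eqP ->.
by rewrite -reg_actM ?groupV // mulgV reg_act1 enum_valK.
Qed.

Lemma reg_ones x : x \in G -> regmod x *m ones^T = ones^T.
Proof.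
move=> Gx; rewrite -[regmod x]trmxK -trmx_mul permmod_orthogonal //.
by rewrite ones_reg ?groupV.
Qed.

Definition induced_counit A : 'M[k]_(gdim (induced A), gdim A) :=
  lin1_mx (mulmx ones \o vec_mx).
Definition induced_unit A : 'M[k]_(gdim A, gdim (induced A)) :=
  lin1_mx (mxvec \o mulmx ones^T).

Lemma induced_counit_hom A : ghom (induced_counit A).
Proof.
move=> x Gx; apply: eq_mxvec_mul => u.
rewrite mulmxA mul_vec_lin mulmxA !mul_rV_lin1 /= !mxvecK !mulmxA.
by rewrite ones_reg ?groupV.
Qed.

Lemma induced_unit_hom A : ghom (induced_unit A).
Proof.
move=> x Gx; apply/row_matrixP => i; rewrite !rowE !mulmxA !mul_rV_lin1 /=.
by rewrite mxvecK !mulmxA; have /= -> := reg_ones (groupVr Gx).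
Qed.

Lemma induced_counit_full A : row_full (induced_counit A).
Proof.
apply/row_fullP; exists (lin1_mx (mxvec \o mulmx (delta_mx (enum_rank 1%g) 0))).
apply/row_matrixP => i; rewrite !rowE mulmxA !mul_rV_lin1 /= mxvecK mulmxA mulmx1.
rewrite -colE (_ : col _ _ = 1%:M) ?mul1mx //.
by apply/rowP => j; rewrite !mxE !ord1.
Qed.

Lemma induced_unit_free A : row_free (induced_unit A).
Proof.
apply/row_freeP; exists (lin1_mx (mulmx (delta_mx 0 (enum_rank 1%g)) \o vec_mx)).
apply/row_matrixP => i; rewrite !rowE mulmxA !mul_rV_lin1 /= mxvecK mulmxA mulmx1.
rewrite -rowE (_ : row _ _ = 1%:M) ?mul1mx //.
by apply/rowP => j; rewrite !mxE !ord1.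
Qed.

Lemma projective_relproj A : projective A -> relproj A.
Proof.
move=> projA.
have hc : induced_counit A \in homG (induced A) A by apply/memh/induced_counit_hom.
have [|h /memh hh h1] := projA _ _ _ _ _ 1%:M hc (induced_counit_full A).
  exact/memh/ghom1.
exact: relproj_retract hh (@induced_counit_hom A) h1 (relproj_induced A).
Qed.

Lemma submodule_ses N m (U : 'M[k]_(m, gdim N)) : mxmodule N U ->
  exists S C f g, @ses _ _ _ S N C f g /\ (f :=: U)%MS.
Proof.
move=> modU; have modV : mxmodule N <<U>>%MS by rewrite (eqmx_module _ (genmxE U)).
exists (GMod (submod_repr modV)), (GMod (factmod_repr modV)).
exists (@val_submod _ _ <<U>>%MS _ 1%:M), (in_factmod <<U>>%MS 1%:M).
have E : (@val_submod _ _ <<U>>%MS _ 1%:M :=: U)%MS.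
  by apply: eqmx_trans (genmxE U); apply: val_submod1.
split=> //; apply: sesI.
- move=> x Gx; rewrite -val_submodE -[X in val_submod X]mul1mx.
  by rewrite (val_submodJ modV).
- move=> x Gx; rewrite -in_factmodE -[X in in_factmod _ X]mul1mx.
  by rewrite (in_factmodJ modV).
- apply/row_freeP; exists (@in_submod _ _ <<U>>%MS _ 1%:M).
  by rewrite -in_submodE val_submodK.
- apply/row_fullP; exists (@val_factmod _ _ <<U>>%MS _ 1%:M).
  by rewrite -in_factmodE val_factmodK.
- apply/eqmxP; apply: eqmx_trans E _; apply/eqmxP/andP; split.
    by apply/sub_kermxP; rewrite -in_factmodE; apply/eqP; rewrite in_factmod_eq0 genmxE.
  by rewrite -(genmxE U) -in_factmod_eq0 in_factmodE mulmx_ker.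
Qed.

End Free.

(** * Syzygies, cosyzygies and Ext *)

Section Chains.
Variables (k : fieldType) (gT : finGroupType) (G : {group gT}).
Implicit Types (A B N X Y Q I : gmod k G) (Z C : nat -> gmod k G).

(** The successive syzygies of Z 0 in some projective resolution, possibly not
    minimal. *)
Definition chain Z := forall t, exists Q i p,
  relproj Q /\ @ses _ _ _ (Z t.+1) Q (Z t) i p.

Definition cochain C := forall t, exists I j q,
  relproj I /\ @ses _ _ _ (C t) I (C t.+1) j q.

(** Ext^t(Z 0, C 0), computed from syzygies of the first argument or from
    cosyzygies of the second one. *)
Lemma sdim_chain_shift Z C t : chain Z -> cochain C ->
  sdim (Z t) (C 0) = sdim (Z 0) (C t).
Proof.
move=> cZ cC; suff E s : sdim (Z t) (C s) = sdim (Z 0) (C (t + s)%N) by rewrite E addn0.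
elim: t s => [|t IHt] s //; rewrite addSnnS -IHt.
have [[Q [i [p [pQ ip]]]] [I [j [q [pI jq]]]]] := (cZ t, cC s).
exact: sdim_shift ip jq pQ pI.
Qed.

Lemma chain_dual C : cochain C -> chain (fun t => gdual (C t)).
Proof.
move=> cC t; have [I [j [q [pI jq]]]] := cC t.
by exists (gdual I), q^T, j^T; split; [apply: relproj_dual | apply: ses_dual].
Qed.

Lemma cochain_dual Z : chain Z -> cochain (fun t => gdual (Z t)).
Proof.
move=> cZ t; have [Q [i [p [pQ ip]]]] := cZ t.
by exists (gdual Q), p^T, i^T; split; [apply: relproj_dual | apply: ses_dual].
Qed.

Lemma cochain_inner B C : cochain C -> cochain (fun t => inner B (C t)).
Proof.
move=> cC t; have [I [j [q [pI jq]]]] := cC t.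
exists (inner B I), (post B j), (post B q).
by split; [apply: relproj_innerr | apply: ses_inner].
Qed.

Lemma cochain_exists N : exists2 C, cochain C & C 0 = N.
Proof.
have /choice[c cP] (A : gmod k G) :
    exists D : gmod k G, exists I j q, relproj I /\ @ses _ _ _ A I D j q.
  have [|S [D [f [g [[hf hg [r [s [fr sg fg sr rs]]]] fE]]]]] :=
    @submodule_ses _ _ _ (induced A) _ (induced_unit A).
    by apply/mxmoduleP => x Gx; rewrite -(induced_unit_hom A) // submxMl.
  exists D, (induced A), (induced_unit A), g; split; first exact: relproj_induced.
  apply: sesI => //; first exact: induced_unit_hom; first exact: induced_unit_free.
    by apply/row_fullP; exists s.
  apply/eqmxP; apply: eqmx_trans (eqmx_sym fE) _; apply/eqmxP/andP; split.
    exact/sub_kermxP.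
  apply/submxP; exists (kermx g *m r).
  by rewrite -mulmxA -[LHS]mulmx1 -rs mulmxDr [_ *m (g *m s)]mulmxA mulmx_ker mul0mx addr0.
by exists (fun t => iter t c N) => // t; apply: cP.
Qed.

(** Ext^t(A^*, N) embeds in Ext^t(A, A (x) A (x) N) for all t at once. Shifting
    moves t from the first argument to N, where the triangle identity applies;
    tensoring the cosyzygies of N gives cosyzygies again. *)
Lemma sdim_dual_chain Z Z' N : chain Z -> chain Z' -> Z' 0 = gdual (Z 0) ->
  exists N', forall t, (sdim (Z' t) N <= sdim (Z t) N')%N.
Proof.
move=> cZ cZ' Z'0; have [C cC C0] := cochain_exists N.
exists (inner (gdual (Z 0)) (inner (gdual (Z 0)) N)) => t.
rewrite -C0 (sdim_chain_shift t cZ' cC) Z'0.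
apply: leq_trans (sdim_triangle _ _) _.
have cC' := cochain_inner (gdual (Z 0)) (cochain_inner (gdual (Z 0)) cC).
by rewrite -(sdim_chain_shift t cZ cC').
Qed.

Section Resolution.
Variables (a : nat) (A : mx_representation k G a) (P : resolution A).

Lemma rdif_module t : mxmodule (rmod P t) <<rdif P t>>%MS.
Proof.
rewrite (eqmx_module _ (genmxE _)); apply/mxmoduleP => x Gx.
by have /homGP/(_ x Gx) <- := rdif_hom P t; rewrite submxMl.
Qed.

(** The module covered by the t-th term of the resolution. *)
Definition syz (t : nat) : gmod k G :=
  if t is s.+1 then GMod (submod_repr (rdif_module s)) else GMod A.

Definition syz_in t : 'M[k]_(gdim (syz t.+1), rdim P t) :=
  @val_submod _ _ <<rdif P t>>%MS _ 1%:M.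

Definition syz_out t : 'M[k]_(rdim P t, gdim (syz t)) :=
  match t with
  | 0 => raug P
  | s.+1 => in_submod <<rdif P s>>%MS (rdif P s)
  end.

Local Notation PP t := (GMod (rmod P t)).

Lemma syz_inE t : (syz_in t :=: rdif P t)%MS.
Proof. by apply: eqmx_trans (genmxE _); apply: val_submod1. Qed.

Lemma syz_comp t : syz_out t.+1 *m syz_in t = rdif P t.
Proof. by rewrite /= -val_submodE in_submodK // genmxE. Qed.

Lemma syz_ses t : @ses _ _ _ (syz t.+1) (PP t) (syz t) (syz_in t) (syz_out t).
Proof.
have in_free s : row_free (syz_in s).
  apply/row_freeP; exists (@in_submod _ _ <<rdif P s>>%MS _ 1%:M).
  by rewrite -in_submodE val_submodK.
have in_hom s : @ghom _ _ _ (syz s.+1) (PP s) (syz_in s).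
  move=> x Gx; rewrite /syz_in -val_submodE -[X in val_submod X]mul1mx.
  by rewrite (val_submodJ (rdif_module s)).
have mono s m (u v : 'M_(m, _)) : u *m syz_in s = v *m syz_in s -> u = v.
  exact: (row_free_inj (in_free s)).
apply: sesI => //; case: t => [|t].
- exact/homGP/raug_hom.
- move=> x Gx; apply: mono; rewrite -[LHS]mulmxA syz_comp -[RHS]mulmxA in_hom //.
  by rewrite [RHS]mulmxA syz_comp; have /homGP/(_ x Gx) := rdif_hom P t.
- exact: raug_onto.
- have /submxP[s Es] : (1%:M *m syz_in t <= rdif P t)%MS by rewrite mul1mx syz_inE.
  apply/row_fullP; exists s; apply: mono.
  by rewrite -mulmxA syz_comp -Es.
- apply/eqmxP; apply: eqmx_trans (syz_inE 0) _; exact/eqmxP/rdif_exact0.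
- apply/eqmxP; apply: eqmx_trans (syz_inE t.+1) _; apply/eqmxP.
  have [dk kd] := andP (rdif_exact P t); apply/andP; split.
    apply/sub_kermxP; apply: mono.
    by rewrite mul0mx -mulmxA syz_comp; apply/sub_kermxP.
  apply: submx_trans kd; apply/sub_kermxP.
  by rewrite -syz_comp mulmxA mulmx_ker mul0mx.
Qed.

Lemma resolution_relproj t : relproj (PP t).
Proof. exact/projective_relproj/rmod_projective. Qed.

Lemma chain_syz : chain syz.
Proof.
move=> t; exists (PP t), (syz_in t), (syz_out t).
by split; [apply: resolution_relproj | apply: syz_ses].
Qed.

Lemma dim_cocycles N t :
  \dim (homG (rmod P t) N :&: lker (linfun (mulmx (rdif P t)))) = hdim (syz t) N.
Proof.
have ho := ses_homr (syz_ses t); have hi := ses_homl (syz_ses t).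
apply/esym; apply: (@eq_dim_bij _ _ _ _ _ (mulmx (syz_out t))).
- move=> u /memh hu; rewrite memv_cap memv_ker lfunE /= -syz_comp -mulmxA.
  rewrite [syz_in t *m _]mulmxA (ses_comp0 (syz_ses t)) mul0mx mulmx0 eqxx andbT.
  exact/(@memh _ _ _ (PP t))/(ghom_mul ho).
- by move=> u _ /= u0; apply: (ses_epi (syz_ses t)); rewrite u0 mulmx0.
- move=> v; rewrite memv_cap memv_ker lfunE /= => /andP[/(@memh _ _ _ (PP t)) hv /eqP v0].
  have [|w hw ->] := ses_cokerP (syz_ses t) hv; last by exists w => //; apply/memh.
  by apply: (ses_epi (syz_ses t.+1)); rewrite mulmxA syz_comp v0 mulmx0.
Qed.

(** A cocycle is a hom from the syzygy, and a coboundary is one that extends to a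
    projective module, that is, a trace. *)
Lemma dim_Ext_sdim N t : dim_Ext P N t.+1 = sdim (syz t.+1) N.
Proof.
rewrite /dim_Ext dim_cocycles /sdim; congr (_ - _)%N.
have E := hdim_relproj_midl (syz_ses t) N (resolution_relproj t).
have := limg_ker_dim (linfun (mulmx (rdif P t))) (homG (rmod P t) N).
rewrite dim_cocycles -[X in _ = X -> _]/(hdim (PP t) N) E => /eqP.
by rewrite eqn_add2l => /eqP.
Qed.

End Resolution.

End Chains.

(** * Tor as the dual of Ext *)

Section Perp.
Variables (k : fieldType) (a b : nat).
Implicit Types U V : {vspace 'M[k]_(a, b)}.

Definition mxdot (X Y : 'M[k]_(a, b)) : k := \tr (X^T *m Y).

Lemma mxdotE X Y : mxdot X Y = \sum_i \sum_j X i j * Y i j.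
Proof.
rewrite /mxdot /mxtrace exchange_big; apply: eq_bigr => j _ /=.
by rewrite mxE; apply: eq_bigr => i _; rewrite mxE.
Qed.

Lemma mxdotC X Y : mxdot X Y = mxdot Y X.
Proof. by rewrite !mxdotE; do 2![apply: eq_bigr => ? _]; rewrite mulrC. Qed.

Lemma mxdot_is_linear X : linear (mxdot X : 'M_(a, b) -> k^o).
Proof. by move=> z Y Y'; rewrite /mxdot mulmxDr -scalemxAr linearP. Qed.
HB.instance Definition _ X := GRing.isLinear.Build k _ k^o *:%R
  (mxdot X : 'M_(a, b) -> k^o) (mxdot_is_linear X).

Lemma mxdot_eq0 X : (forall Y, mxdot X Y = 0) -> X = 0.
Proof.
move=> X0; apply/matrixP=> i j; rewrite mxE -(X0 (delta_mx i j)) mxdotE.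
rewrite (bigD1 i) //= (bigD1 j) //= mxE !eqxx mulr1 !big1 ?addr0 //.
  by move=> i' /negPf ne; apply: big1 => j' _; rewrite mxE ne mulr0.
by move=> j' /negPf ne; rewrite mxE ne andbF mulr0.
Qed.

(** The form is nondegenerate but may have isotropic vectors, so orthogonals are
    compared through their dimensions. *)
Definition perp U : {vspace 'M[k]_(a, b)} :=
  (\bigcap_(i < \dim U) lker (linfun (mxdot (vbasis U)`_i : 'M_(a, b) -> k^o)))%VS.

Lemma perpP U Y : reflect (forall X, X \in U -> mxdot X Y = 0) (Y \in perp U).
Proof.
rewrite memvE; apply: (iffP subv_bigcapP) => [Y0 X UX|Y0 i _].
  rewrite (coord_vbasis UX) mxdotC linear_sum big1 // => i _.
  rewrite linearZ /= mxdotC; have := Y0 i isT.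
  by rewrite -memvE memv_ker lfunE /= => /eqP ->; rewrite scaler0.
rewrite -memvE memv_ker lfunE /= Y0 //; apply: vbasis_mem.
by rewrite mem_nth ?size_tuple.
Qed.

Lemma dim_perp U : \dim (perp U) = (a * b - \dim U)%N.
Proof.
pose B := \matrix_(i < \dim U) mxvec (vbasis U)`_i.
pose l := [the {linear 'M[k]_(a, b) -> 'rV[k]_(\dim U)} of mulmxr B^T \o mxvec].
have lE Y i : l Y 0 i = mxdot (vbasis U)`_i Y.
  rewrite mxdotC mxdotE pair_big /= mxE (reindex _ (curry_mxvec_bij _ _)) /=.
  by apply: eq_bigr => -[i' j'] _; rewrite !mxE !mxvecE.
have kE : (fullv :&: lker (linfun l) = perp U)%VS.
  rewrite capfv; apply/vspaceP => Y; rewrite memv_ker lfunE.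
  apply/eqP/perpP => [/rowP Y0 X UX|Y0].
    rewrite (coord_vbasis UX) mxdotC linear_sum big1 // => i _.
    by rewrite linearZ /= mxdotC -lE Y0 mxE scaler0.
  by apply/rowP=> i; rewrite lE mxE Y0 // vbasis_mem // mem_nth ?size_tuple.
have freeB : row_free B.
  rewrite -kermx_eq0; apply/rowV0P => v /sub_kermxP vB; apply/rowP => i.
  have /freeP fr := basis_free (vbasisP U); rewrite mxE fr //.
  apply: (can_inj mxvecK); rewrite linear0; apply: etrans vB.
  rewrite linear_sum mulmx_sum_row; apply: eq_bigr => j _.
  by rewrite linearZ rowK.
have iE : limg (linfun l) = fullv.
  apply/vspaceP => r; rewrite memvf; apply/memv_imgP.
  have /row_freeP[D BD] := freeB; have DB : D^T *m B^T = 1%:M by rewrite -trmx_mul BD trmx1.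
  exists (vec_mx (r *m D^T)); rewrite ?memvf // lfunE /= vec_mxK -mulmxA DB mulmx1 //.
suff E : (\dim (perp U) + 1 * \dim U = a * b)%N by rewrite -E mul1n addnK.
by have := limg_ker_dim (linfun l) fullv; rewrite kE iE !dimvf !dim_matrix.
Qed.

Lemma dim_perpK U : (\dim U + \dim (perp U) = a * b)%N.
Proof.
rewrite dim_perp subnKC //; have := dimvS (subvf U).
by rewrite dimvf dim_matrix.
Qed.

Lemma perpK U : perp (perp U) = U.
Proof.
apply/esym/eqP; rewrite eqEdim; apply/andP; split.
  by apply/subvP => X UX; apply/perpP => Y /perpP YU; rewrite mxdotC YU.
by rewrite -(leq_add2l (\dim (perp U))) dim_perpK addnC dim_perpK.
Qed.

End Perp.

Section TorExt.
Variables (k : fieldType) (gT : finGroupType) (G : {group gT}).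
Implicit Types (A B N : gmod k G).

Lemma mxdot_mul a b c (D : 'M[k]_(a, c)) (X : 'M[k]_(a, b)) (Y : 'M[k]_(c, b)) :
  mxdot (D^T *m X) Y = mxdot X (D *m Y).
Proof. by rewrite /mxdot trmx_mul trmxK mulmxA. Qed.

(** The dual of A (x)_G B is Hom_G(A, B^* ). *)
Lemma perp_tensG_rel A B : perp (tensG_rel A B) = homG A (gdual B).
Proof.
have dotE x X Y : mxdot ((A x)^T *m (X *m B x) - X) Y =
    mxdot X (A x *m Y *m (B x)^T - Y).
  rewrite mxdotC !linearB /= [mxdot Y X]mxdotC mxdotC mxdot_mul; congr (_ - _).
  by rewrite /mxdot trmx_mul -!mulmxA mxtrace_mulC !mulmxA.
apply/vspaceP => Y; apply/perpP/(@memh _ _ _ A (gdual B)) => [Y0|hY _ /memv_sumP[F FP ->]].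
  have E x : x \in G -> A x *m Y *m (B x)^T = Y.
    move=> Gx; apply/subr0_eq/mxdot_eq0 => X; rewrite mxdotC -dotE Y0 //.
    apply: (subvP (sumv_sup x Gx (subvv _))).
    by apply/memv_imgP; exists X; rewrite ?memvf ?lfunE.
  move=> x Gx /=; rewrite -{2}(E x Gx) -[RHS]mulmxA -trmx_mul -repr_mxM ?groupV //.
  by rewrite mulVg repr_mx1 trmx1 mulmx1.
rewrite mxdotC linear_sum big1 // => x Gx; rewrite /= mxdotC.
have /memv_imgP[X _ ->] := FP x Gx; rewrite lfunE /= dotE hY // -mulmxA -trmx_mul.
by rewrite -repr_mxM ?groupV // mulgV repr_mx1 trmx1 mulmx1 subrr linear0.
Qed.

(** Tor_t(A, N)^* is Ext^t(A, N^* ): taking orthogonals exchanges cycles with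
    coboundaries and boundaries with cocycles. *)
Lemma dim_Tor_Ext a (A : mx_representation k G a) (Q : resolution A) N t :
  dim_Tor Q N t = dim_Ext Q (gdual N) t.
Proof.
have HE s : perp (homG (rmod Q s) (gdual N)) = tensG_rel (rmod Q s) N.
  by rewrite -(perp_tensG_rel (GMod (rmod Q s))) perpK.
have Eb : tens_boundaries Q N t =
    perp (homG (rmod Q t) (gdual N) :&: lker (linfun (mulmx (rdif Q t)))).
  rewrite -[LHS]perpK; congr perp; apply/vspaceP => Y.
  rewrite memv_cap memv_ker lfunE /= -(perp_tensG_rel (GMod (rmod Q t))).
  apply/perpP/andP => [Y0|[/perpP Yr /eqP Yd] X].
    split; first by apply/perpP => X rX; apply: Y0; rewrite (subvP (addvSr _ _)).
    apply/eqP/mxdot_eq0 => X; rewrite mxdotC -mxdot_mul; apply: Y0.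
    by rewrite (subvP (addvSl _ _)) //; apply/memv_imgP; exists X; rewrite ?memvf ?lfunE.
  case/memv_addP=> _ /memv_imgP[V _ ->] [W rW ->]; rewrite mxdotC linearD /=.
  by rewrite lfunE /= ![mxdot Y _]mxdotC mxdot_mul Yd linear0 Yr ?addr0.
have Ec : tens_cycles Q N t = if t is s.+1 then
    perp (linfun (mulmx (rdif Q s)) @: homG (rmod Q s) (gdual N)) else fullv.
  case: t {Eb} => //= s; apply/vspaceP => X; rewrite -memv_preim lfunE /= -HE.
  apply/perpP/perpP => [X0 _ /memv_imgP[Y hY ->]|X0 Y hY].
    by rewrite lfunE /= mxdotC -mxdot_mul mxdotC X0.
  by rewrite mxdotC mxdot_mul mxdotC X0 //; apply/memv_imgP; exists Y; rewrite ?lfunE.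
rewrite /dim_Tor /dim_Ext Eb Ec; case: t {Eb Ec} => [|s].
  rewrite dimvf dim_matrix dim_perp.
  set d := \dim _; have : (d <= rdim Q 0 * gdim N)%N.
    by have := dimvS (subvf (homG (rmod Q 0) (gdual N) :&:
      lker (linfun (mulmx (rdif Q 0))))); rewrite dimvf dim_matrix.
  by move=> ?; rewrite subKn // subn0.
rewrite !dim_perp; set U := (_ @: _)%VS; set V := (_ :&: _)%VS.
have := dimvS (subvf U); have := dimvS (subvf V); rewrite !dimvf !dim_matrix /=.
move: (\dim U) (\dim V) => u v.
rewrite -[X in (v <= X)%N -> _]/(rdim Q s.+1 * gdim N)%N.
rewrite -[X in _ -> (u <= X)%N -> _]/(rdim Q s.+1 * gdim N)%N.
by move: (rdim Q s.+1 * gdim N)%N => n; lia.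
Qed.

End TorExt.

(** * Restriction and Frobenius reciprocity *)

Section Restriction.
Variables (k : fieldType) (gT : finGroupType) (G H : {group gT}).
Hypothesis sHG : H \subset G.
Implicit Types (A B C N X Q : gmod k G) (Z : nat -> gmod k G).

Definition gres A : gmod k H := GMod (subg_repr A sHG).

Lemma ghom_res A B f : @ghom _ _ _ A B f -> @ghom _ _ _ (gres A) (gres B) f.
Proof. by move=> hf x Hx; apply: hf; apply: (subsetP sHG). Qed.

Lemma ses_res A B C f g : @ses _ _ _ A B C f g ->
  @ses _ _ _ (gres A) (gres B) (gres C) f g.
Proof. by case=> hf hg rs; split=> //; apply: ghom_res. Qed.

Lemma sum_lcosets (V : nmodType) (F : gT -> V) :
  \sum_(x in G) F x =
  \sum_(r in G | repr (r *: H)%g == r) \sum_(h in H) F (r * h)%g.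
Proof.
rewrite (partition_big (fun x => repr (x *: H)%g)
  (fun r => (r \in G) && (repr (r *: H)%g == r))) /=; last first.
  move=> x Gx; have xr : repr (x *: H)%g \in (x *: H)%g.
    by apply: (mem_repr x); apply: lcoset_refl.
  rewrite (lcoset_eqP xr) eqxx andbT.
  by have := subsetP (mulgS [set x] sHG) _ xr; rewrite mem_lcoset groupMl ?groupV.
apply: eq_bigr => r /andP[Gr /eqP rr]; rewrite (reindex_inj (mulgI r)) /=.
apply: eq_bigl => h; apply/andP/idP => [[Grh /eqP E]|Hh].
  have : (r * h)%g \in (r *: H)%g.
    rewrite -lcoset_sym -{1}E; apply: (mem_repr (r * h)%g); exact: lcoset_refl.
  by rewrite mem_lcoset mulKg.
rewrite groupM ?(subsetP sHG h) //; split=> //.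
rewrite -{2}rr; apply/eqP; congr (repr _); apply/lcoset_eqP.
by rewrite mem_lcoset mulKg.
Qed.

Lemma relproj_res A : relproj A -> relproj (gres A).
Proof.
move=> [th th1].
exists (\sum_(r in G | repr (r *: H)%g == r) A r^-1%g *m th *m A r).
rewrite -th1 /trc sum_lcosets exchange_big /=; apply: eq_bigr => h Hh.
have Gh := subsetP sHG h Hh.
rewrite mulmx_sumr mulmx_suml; apply: eq_bigr => r /andP[Gr _].
by rewrite invMg !repr_mxM ?groupV // !mulmxA.
Qed.

Lemma chain_res Z : chain Z -> chain (fun t => gres (Z t)).
Proof.
move=> cZ t; have [Q [i [p [pQ ip]]]] := cZ t.
by exists (gres Q), i, p; split; [apply: relproj_res | apply: ses_res].
Qed.

Lemma gdual_res A : gdual (gres A) = gres (gdual A).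
Proof.
rewrite /gres /=; congr GMod; rewrite /subg_repr /=.
congr MxRepresentation; exact: Prop_irrelevance.
Qed.

Section Frobenius.
Variables (T : finType) (act : T -> gT -> T).
Hypothesis act1 : forall t, act t 1%g = t.
Hypothesis actM : {in G &, forall x y t, act t (x * y)%g = act (act t x) y}.
Variable t0 : T.
Hypothesis stab_t0 : {in G, forall x, (x \in H) = (act t0 x == t0)}.
Hypothesis trans_t0 : forall t, exists2 x, x \in G & t = act t0 x.
Local Notation kT := (permmod k act1 actM).
Local Notation e t := (delta_mx (enum_rank t) 0 : 'cV[k]_#|T|).

Lemma col_permmod x t : x \in G -> kT x *m e t = e (act t x^-1%g).
Proof.
move=> Gx; rewrite -colE; apply/colP => i; rewrite !mxE eqxx andbT enum_rankK.
congr (nat_of_bool _)%:R; apply/eqP/eqP => [->|->]; last first.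
  by rewrite enum_rankK -actM ?groupV // mulVg act1.
by rewrite -actM ?groupV // mulgV act1 enum_valK.
Qed.

(** Frobenius reciprocity: a hom to a transitive permutation module is determined
    by its coordinate at the base point, a linear form fixed by the stabiliser. *)
Lemma hdim_frobenius X : hdim X kT = hdim (gres X) (GMod (triv_repr k H)).
Proof.
apply: (@eq_dim_bij _ _ _ _ _ (mulmxr (e t0))).
- move=> u /(@memh _ _ _ X kT) hu; apply/(@memh _ _ _ (gres X) (GMod (triv_repr k H))) => x Hx.
  have Gx := subsetP sHG x Hx; rewrite /= mulmx1 mulmxA hu // -mulmxA.
  rewrite [kT x *m _]col_permmod //; congr (_ *m e _); apply/eqP.
  by rewrite -stab_t0 ?groupV.
- move=> u /(@memh _ _ _ X kT) hu /= u0; apply: trmx_inj; apply: eq_row_enum => t.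
  rewrite trmx0 row0 -tr_col colE; have [y Gy ->] := trans_t0 t.
  rewrite -[y]invgK -col_permmod ?groupV // mulmxA.
  by rewrite -[u *m _]hu ?groupV // -mulmxA u0 mulmx0 trmx0.
- move=> v /(@memh _ _ _ (gres X) (GMod (triv_repr k H))) hv.
  have /fin_all_exists2[y Gy yE] := trans_t0.
  pose u : 'M_(gdim X, #|T|) := \matrix_(i, j) (X (y (enum_val j))^-1%g *m v) i 0.
  have uE t : u *m e t = X (y t)^-1%g *m v.
    by rewrite -colE; apply/colP => i; rewrite !mxE enum_rankK.
  exists u; last first.
    have Hy : y t0 \in H by rewrite stab_t0 ?Gy // -yE.
    by have := hv _ (groupVr Hy); rewrite /= mulmx1 uE => ->.
  apply/(@memh _ _ _ X kT) => x Gx; apply: trmx_inj; apply: eq_row_enum => t.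
  rewrite -!tr_col !colE; congr trmx; rewrite -!mulmxA col_permmod // !uE.
  set t' := act t _; have Hh : (y t' * x * (y t)^-1)%g \in H.
    rewrite stab_t0 ?groupM ?groupV ?Gy // !actM ?groupM ?groupV ?Gy // -yE.
    have -> : act t' x = t by rewrite /t' -actM ?groupV // mulVg act1.
    by rewrite {1}(yE t) -actM ?groupV ?Gy // mulgV act1 eqxx.
  have := hv _ Hh; rewrite /= mulmx1 => {2}<-.
  rewrite !mulmxA -!repr_mxM ?groupM ?groupV ?Gy //.
by rewrite !mulgA mulVg mul1g.
Qed.

End Frobenius.
End Restriction.

(** * Growth of sequences *)

Lemma leq_exp2r_weak a b c : (a <= b)%N -> (a ^ c <= b ^ c)%N.
Proof. by case: c => [//|c] ab; rewrite leq_exp2r. Qed.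

Section Growth.
Implicit Types (V W : nat -> nat) (c : nat).

(** Multiplying by t clears the exponent c - 1, which is negative when c = 0, and
    leaves a statement on natural numbers. *)
Definition grows V c := exists K : nat, forall t, (0 < t)%N -> (V t * t <= K * t ^ c)%N.

Lemma growsP V c : growth_le V c <-> grows V c.
Proof.
have E (K : rat) t : (0 < t)%N ->
    ((V t)%:R <= K * t%:R ^ (c%:Z - 1)) = ((V t * t)%:R <= K * (t ^ c)%:R).
  move=> t0; have tn0 : (t%:R : rat) != 0 by rewrite pnatr_eq0 -lt0n.
  rewrite expfzDr // -exprnP exprN1 mulrA ler_pdivlMr ?ltr0n // natrM natrX.
  by [].
split=> [[K KP]|[K KP]].
  have K0 : 0 <= K by have := KP 1%N isT; rewrite exp1rz mulr1 => /(le_trans (ler0n _ _)).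
  exists (Num.bound K) => t t0; rewrite -(ler_nat rat).
  have := KP t t0; rewrite E // => /le_trans; apply.
  by rewrite [leRHS]natrM ler_wpM2r ?ler0n //; apply/ltW/archi_boundP.
by exists K%:R => t t0; rewrite E // -natrM ler_nat KP.
Qed.

(** The values at 0 and 1 do not affect the growth; most bounds on Ext^t below
    only hold from t = 1 or t = 2 on. *)
Lemma grows_le V W c : (forall t, (1 < t)%N -> (V t <= W t)%N) -> grows W c -> grows V c.
Proof.
move=> VW [K KP]; exists (K + V 1)%N => -[//|[|t]] _; first by rewrite exp1n; lia.
have le1 := KP t.+2 isT; have le2 := VW t.+2 isT.
apply: leq_trans (leq_mul le2 (leqnn _)) (leq_trans le1 _).
by rewrite leq_mul2r leq_addr orbT.
Qed.

Lemma growsD V W c : grows V c -> grows W c -> grows (fun t => V t + W t)%N c.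
Proof.
move=> [K KP] [L LP]; exists (K + L)%N => t t0.
by rewrite !mulnDl leq_add ?KP ?LP.
Qed.

Lemma growsM V c n : grows V c -> grows (fun t => n * V t)%N c.
Proof.
move=> [K KP]; exists (n * K)%N => t t0.
by rewrite -!mulnA leq_mul2l KP ?orbT.
Qed.

Lemma grows_succ V c : grows V c -> grows (fun t => V t.+1) c.
Proof.
move=> [K KP]; exists (K * 2 ^ c)%N => t t0.
apply: leq_trans (leq_mul (leqnn _) (leqnSn t)) (leq_trans (KP t.+1 isT) _).
by rewrite -mulnA -expnMn leq_mul2l leq_exp2r_weak ?orbT // mul2n -addnn -addn1 leq_add2l.
Qed.

Lemma grows_pred V c : grows V c -> grows (fun t => V t.-1) c.
Proof.
move=> [K KP]; exists (2 * K + V 0)%N => -[//|[|t]] _; first by rewrite exp1n !muln1 leq_addl.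
have le1 := KP t.+1 isT; rewrite mulnDl; apply: leq_trans (leq_addr _ _).
have le2 : (K * t.+1 ^ c <= K * t.+2 ^ c)%N by rewrite leq_mul2l leq_exp2r_weak ?orbT.
rewrite /= -mulnA; move: le1 le2; move: (V t.+1) (K * _)%N (K * _)%N => v a b; nia.
Qed.

Lemma growsW V c d : (c <= d)%N -> grows V c -> grows V d.
Proof.
move=> cd [K KP]; exists K => t t0; apply: leq_trans (KP t t0) _.
by rewrite leq_mul2l leq_pexp2l ?orbT.
Qed.

End Growth.

(** * Two-out-of-three and subquotients *)

Section Subquotients.
Variables (k : fieldType) (gT : finGroupType) (G : {group gT}).
Implicit Types (A B C D N X Y : gmod k G) (T : gmod k G -> Prop).

(** The two-out-of-three property for short exact sequences. *)
Record thick T : Prop := Thick {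
  thick_zero : forall A, gdim A = 0%N -> T A;
  thick_mid : forall A B C f g, @ses _ _ _ A B C f g -> T A -> T C -> T B;
  thick_sub : forall A B C f g, @ses _ _ _ A B C f g -> T B -> T C -> T A;
  thick_quot : forall A B C f g, @ses _ _ _ A B C f g -> T A -> T B -> T C }.

(** All subquotients Y of N have T, a subquotient being a quotient of a
    submodule X. Unlike T, this passes to submodules and quotients. *)
Definition hered T N := forall X Y i q, @ghom _ _ _ X N i -> row_free i ->
  @ghom _ _ _ X Y q -> row_full q -> T Y.

Variable T : gmod k G -> Prop.
Hypothesis tT : thick T.

Lemma full_gdim0 X Y (q : 'M[k]_(gdim X, gdim Y)) :
  row_full q -> gdim X = 0%N -> gdim Y = 0%N.
Proof.
by move=> /eqP uq X0; have := rank_leq_row q; rewrite uq X0 leqn0 => /eqP.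
Qed.

Lemma zero_mx_repr : mx_repr G (fun _ : gT => 0 : 'M[k]_0).
Proof. by split=> [|x y _ _]; apply/matrixP => -[]. Qed.
Definition gzero := GMod (MxRepresentation zero_mx_repr).

Lemma iso_ses A B f : @ghom _ _ _ A B f -> row_free f -> row_full f ->
  @ses _ _ _ A B gzero f 0.
Proof.
move=> hf ff uf; apply: sesI => //; first exact: ghom0.
  by rewrite /row_full -leqn0 rank_leq_col.
by apply/andP; split; [apply/sub_kermxP; rewrite mulmx0 | apply: submx_full].
Qed.

Lemma thick_iso A B f : @ghom _ _ _ A B f -> row_free f -> row_full f ->
  T A <-> T B.
Proof.
move=> hf ff uf; have E := iso_ses hf ff uf.
have z : T gzero by apply: (thick_zero tT).
by split=> [TA|TB]; [apply: (thick_mid tT E) | apply: (thick_sub tT E)].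
Qed.

Lemma free_mono m n (i : 'M[k]_(m, n)) : row_free i ->
  forall p (u v : 'M[k]_(p, m)), u *m i = v *m i -> u = v.
Proof. by move=> fi p; apply: row_free_inj. Qed.

Lemma ghom_cancelr A B C f g : @ghom _ _ _ B C g -> row_free g ->
  @ghom _ _ _ A C (f *m g) -> @ghom _ _ _ A B f.
Proof.
move=> hg fg hfg x Gx; apply: (free_mono fg).
by rewrite -[LHS]mulmxA hfg // -[RHS]mulmxA hg // mulmxA.
Qed.

Lemma hered_self N : hered T N -> T N.
Proof.
move=> sN; apply: (sN N N 1%:M 1%:M); try exact: ghom1.
  by rewrite row_free_unit unitmx1.
by rewrite row_full_unit unitmx1.
Qed.

Lemma hered_sub N N' j : @ghom _ _ _ N' N j -> row_free j -> hered T N -> hered T N'.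
Proof.
move=> hj fj sN X Y i q hi fi hq uq; apply: (sN X Y (i *m j) q) => //.
  exact: ghom_mul.
move/row_freeP: fi => [i' ii']; move/row_freeP: fj => [j' jj'].
by apply/row_freeP; exists (j' *m i'); rewrite -mulmxA [j *m _]mulmxA jj' mul1mx.
Qed.

(** A submodule of N' is the image of its preimage in N. *)
Lemma hered_quot N N' g : @ghom _ _ _ N N' g -> row_full g -> hered T N -> hered T N'.
Proof.
move=> hg ug sN X Y i q hi fi hq uq.
pose U := kermx (g *m cokermx i).
have UP m (v : 'M_(m, _)) : (v <= U)%MS = (v *m g <= i)%MS.
  by rewrite [RHS]submxE -mulmxA; apply/sub_kermxP/eqP.
have modU : mxmodule N U.
  apply/mxmoduleP => x Gx; rewrite UP -mulmxA hg // mulmxA.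
  have /submxP[w ->] : (U *m g <= i)%MS by rewrite -UP.
  by rewrite -mulmxA -hi // mulmxA submxMl.
have [S [D [f [p [sfp fE]]]]] := submodule_ses modU.
have /submxP[h hE] : (f *m g <= i)%MS by rewrite -UP fE.
have ff : row_free f.
  by case: sfp => _ _ [r [s [fr _ _ _ _]]]; apply/row_freeP; exists r.
have hh : @ghom _ _ _ S X h.
  by apply: (ghom_cancelr hi fi); rewrite -hE; apply: ghom_mul hg; apply: ses_homl sfp.
apply: (sN S Y f (h *m q)) => //; first exact: ses_homl sfp.
  exact: ghom_mul.
move/row_fullP: ug => [g' g'g]; move/row_fullP: uq => [q' q'q].
have /submxP[w wE] : (i *m g' <= f)%MS by rewrite fE UP -mulmxA g'g mulmx1.
apply/row_fullP; exists (q' *m w); rewrite -mulmxA [w *m _]mulmxA.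
have -> : w *m h = 1%:M.
  by apply: (free_mono fi); rewrite -mulmxA -hE mulmxA -wE -mulmxA g'g mulmx1 mul1mx.
by rewrite mul1mx.
Qed.

(** A subquotient of B is an extension of a subquotient of C by one of A. *)
Lemma hered_ext A B C f g : @ses _ _ _ A B C f g -> hered T A -> hered T C -> hered T B.
Proof.
move=> sfg sA sC X Y i q hi fi hq uq.
have hg := ses_homr sfg; have hig := ghom_mul hi hg.
have modK : mxmodule X (kermx (i *m g)).
  apply/mxmoduleP => x Gx; apply/sub_kermxP.
  by rewrite -mulmxA hig // mulmxA mulmx_ker mul0mx.
have [K [X'' [ka [pi [skp kaE]]]]] := submodule_ses modK.
have kaig : ka *m (i *m g) = 0 by apply/sub_kermxP; rewrite kaE.
have hka := ses_homl skp; have hpi := ses_homr skp.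
have [a ha aE] : exists2 a : 'M_(gdim K, gdim A), @ghom _ _ _ K A a & ka *m i = a *m f.
  by apply: (ses_kerP sfg); [apply: ghom_mul | rewrite -mulmxA].
have [c hc cE] := ses_cokerP skp hig kaig.
have modY : mxmodule Y (ka *m q).
  by apply/mxmoduleP => x Gx; have <- := ghom_mul hka hq Gx; apply: submxMl.
have [Y' [Y'' [j [p [sjp jE]]]]] := submodule_ses modY.
have /submxP[q' qE'] : (ka *m q <= j)%MS by rewrite jE.
have kaqp : ka *m (q *m p) = 0 by rewrite mulmxA qE' -mulmxA (ses_comp0 sjp) mulmx0.
have hqp := ghom_mul hq (ses_homr sjp).
have [q'' hq'' qE''] := ses_cokerP skp hqp kaqp.
case: (skp) => _ _ [rk [sk [kark sk1 kapi skrk rkska]]].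
case: (sjp) => _ _ [rj [sj [jrj sj1 jp sjrj rjsj]]].
have fj : row_free j by apply/row_freeP; exists rj.
apply: (thick_mid tT sjp).
  apply: (sA K Y' a q') => //.
  - move/row_freeP: fi => [i' ii']; apply/row_freeP; exists (f *m i' *m rk).
    by rewrite !mulmxA -aE -[_ *m i *m i']mulmxA ii' mulmx1.
  - by apply: (ghom_cancelr (ses_homl sjp) fj); rewrite -qE'; apply: ghom_mul.
  - have /submxP[w wE] : (j <= ka *m q)%MS by rewrite jE.
    apply/row_fullP; exists w; apply: (free_mono fj).
    by rewrite -mulmxA -qE' -wE mul1mx.
apply: (sC X'' Y'' c q'') => //.
- rewrite -kermx_eq0; apply/rowV0P => v /sub_kermxP vc.
  rewrite -[v]mulmx1 -sk1 mulmxA.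
  have /submxP[w ->] : (v *m sk <= ka)%MS.
    by rewrite kaE; apply/sub_kermxP; rewrite cE mulmxA -[_ *m pi]mulmxA sk1 mulmx1.
  by rewrite -mulmxA kapi mulmx0.
- move/row_fullP: uq => [r rq]; apply/row_fullP; exists (sj *m r *m pi).
  by rewrite -!mulmxA -qE'' [r *m _]mulmxA rq mul1mx.
Qed.

Lemma hered_simple D : T D ->
  (forall U : 'M[k]_(gdim D), mxmodule D U -> U = 0 \/ row_full U) -> hered T D.
Proof.
move=> TD simD X Y i q hi fi hq uq.
have simD' m (U : 'M_(m, gdim D)) : mxmodule D U -> U = 0 \/ row_full U.
  move=> modU; have [|U0|fU] := simD <<U>>%MS; first by rewrite (eqmx_module _ (genmxE U)).
    by left; apply/eqP; rewrite -submx0 -U0 genmxE.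
  by right; rewrite /row_full -(mxrank_gen U).
have modi : mxmodule D i by apply/mxmoduleP => x Gx; rewrite -hi // submxMl.
case: (simD' _ _ modi) => [i0|ui].
  apply: (thick_zero tT); apply: (full_gdim0 uq); move: fi.
  by rewrite i0 /row_free mxrank0 => /eqP.
have modU : mxmodule D (kermx q *m i).
  apply/mxmoduleP => x Gx; rewrite -mulmxA -hi // mulmxA submxMr //.
  by apply/sub_kermxP; rewrite -mulmxA hq // mulmxA mulmx_ker mul0mx.
case: (simD' _ _ modU) => [q0|uU].
  have fq : row_free q.
    by rewrite -kermx_eq0; apply/eqP/(free_mono fi); rewrite mul0mx.
  by apply/(thick_iso hq fq uq)/(thick_iso hi fi ui).
apply: (thick_zero tT); move/row_fullP: uU => [w wE].
have : q = 0.
  have /row_freeP[i' ii'] := fi; rewrite -[q]mul1mx -ii' -[i]mulmx1.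
  have -> : i *m 1%:M *m i' = i *m w *m kermx q by
    apply: (free_mono fi); rewrite mulmx1 ii' mul1mx -mulmxA -[i *m w *m _]mulmxA wE mulmx1.
  by rewrite -mulmxA mulmx_ker mulmx0.
by move=> q0; move: uq; rewrite q0 /row_full mxrank0 => /eqP.
Qed.

Section Sum.
Variables A B : gmod k G.

Lemma sum_mx_repr : mx_repr G (fun x => block_mx (A x) 0 0 (B x)).
Proof.
split=> [|x y Gx Gy]; first by rewrite !repr_mx1 -scalar_mx_block.
by rewrite mulmx_block !mulmx0 !mul0mx !addr0 !add0r !repr_mxM.
Qed.
Definition gsum := GMod (MxRepresentation sum_mx_repr).

Lemma gsum_ses : @ses _ _ _ A gsum B (row_mx 1%:M 0) (col_mx 0 1%:M).
Proof.
split.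
- by move=> x Gx; rewrite /= mul_mx_row mul_row_block !mulmx0 !mul0mx mulmx1 mul1mx !addr0.
- by move=> x Gx; rewrite /= mul_block_col mul_col_mx !mulmx0 !mul0mx mulmx1 mul1mx !add0r.
- exists (col_mx 1%:M 0), (row_mx 0 1%:M).
  split; rewrite ?mul_row_col ?mulmx0 ?mul0mx ?mulmx1 ?addr0 ?add0r //.
  rewrite !mul_col_row !mulmx1 ?mulmx0 ?mul0mx.
  by rewrite add_block_mx !addr0 !add0r -scalar_mx_block.
Qed.

Lemma hered_sum : hered T A -> hered T B -> hered T gsum.
Proof. exact: hered_ext gsum_ses. Qed.

End Sum.

End Subquotients.

(** * The growth of a minimal resolution *)

Section ChainGrowth.
Variables (k : fieldType) (gT : finGroupType) (G : {group gT}).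
Implicit Types (A B C N X Q : gmod k G) (Z : nat -> gmod k G).

Lemma hdim_leq X N : (hdim X N <= gdim X * gdim N)%N.
Proof. by have := dimvS (subvf (homG X N)); rewrite dimvf dim_matrix. Qed.

Lemma sdim_hdim X N : (sdim X N <= hdim X N)%N.
Proof. exact: leq_subr. Qed.

Lemma ses_gdim A B C f g : @ses _ _ _ A B C f g -> (gdim A + gdim C = gdim B)%N.
Proof.
case=> _ _ [r [s [fr sg fg sr rs]]].
have /eqP <- : row_full g by apply/row_fullP; exists s.
have /eqP <- : row_free f by apply/row_freeP; exists r.
have -> : \rank f = \rank (kermx g).
  apply/eqmx_rank/andP; split; first exact/sub_kermxP.
  rewrite -[kermx g]mulmx1 -rs mulmxDr [_ *m (g *m s)]mulmxA mulmx_ker mul0mx addr0.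
  by rewrite mulmxA submxMl.
by rewrite mxrank_ker subnK // rank_leq_row.
Qed.

Section Ses.
Variables (Z Q X N' N N'' : gmod k G).
Variables (i : 'M[k]_(gdim Z, gdim Q)) (p : 'M[k]_(gdim Q, gdim X)).
Variables (f : 'M[k]_(gdim N', gdim N)) (g : 'M[k]_(gdim N, gdim N'')).
Hypotheses (ip : ses i p) (fg : ses f g) (projQ : relproj Q).

Lemma sdimE Y : (sdim Z Y + hdim Q Y = hdim Z Y + hdim X Y)%N.
Proof.
rewrite (hdim_relproj_midl ip Y projQ) /sdim; have := tdim_le Z Y; lia.
Qed.

Lemma sdim_mid : (sdim Z N <= sdim Z N' + sdim Z N'')%N.
Proof.
have := (sdimE N, sdimE N', sdimE N''); case=> [[]].
have := hdim_right_relproj fg projQ.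
have := hdim_left_exact fg Z; have := hdim_left_exact fg X; lia.
Qed.

Lemma sdim_sub : (sdim Z N' <= sdim Z N + sdim X N'')%N.
Proof.
have := (sdimE N, sdimE N', sdimE N''); case=> [[]].
have := hdim_right_relproj fg projQ.
have := hdim_cokernel_bound fg Z; have := hdim_cokernel_bound fg X; lia.
Qed.

Lemma sdim_quot (W R : gmod k G) (j : 'M[k]_(gdim W, gdim R)) (q : 'M[k]_(gdim R, gdim Z)) :
  ses j q -> relproj R -> (sdim Z N'' <= sdim Z N + sdim W N')%N.
Proof.
move=> jq projR; have := (sdimE N, sdimE N', sdimE N''); case=> [[]].
have := hdim_right_relproj fg projQ.
have := hdim_connecting_bound ip fg projQ; have := hdim_connecting_bound jq fg projR.
lia.
Qed.

End Ses.

(** The long exact sequence of Ext, as inequalities between dimensions. *)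
Lemma thick_chain Z c : chain Z -> thick (fun N => grows (fun t => sdim (Z t) N) c).
Proof.
move=> cZ; split=> [A A0|A B C f g fg gA gC|A B C f g fg gB gC|A B C f g fg gA gB].
- exists 0%N => t _; have := leq_trans (sdim_hdim (Z t) A) (hdim_leq (Z t) A).
  by rewrite A0 muln0 leqn0 => /eqP ->.
- apply: grows_le (growsD gA gC) => -[//|t] _.
  by have [Q [i [p [pQ ip]]]] := cZ t; apply: sdim_mid ip fg pQ.
- apply: grows_le (growsD gB (grows_pred gC)) => -[//|t] _.
  by have [Q [i [p [pQ ip]]]] := cZ t; apply: sdim_sub ip fg pQ.
- apply: grows_le (growsD gB (grows_succ gA)) => -[//|t] _.
  have [Q [i [p [pQ ip]]]] := cZ t; have [R [j [q [pR jq]]]] := cZ t.+1.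
  exact: sdim_quot ip fg pQ _ _ _ _ jq pR.
Qed.

Lemma hdim_regmod X : hdim X (regmod k G) = gdim X.
Proof.
rewrite (@hdim_frobenius _ _ G 1%G (sub1G G) _ _ _ _ 1%g) => [|x Gx|t].
- rewrite /hdim (_ : homG _ _ = fullv) ?dimvf ?dim_matrix ?mulr1 //.
  apply/vspaceP => f; rewrite memvf; apply/homGP => x /set1P ->.
  by rewrite !repr_mx1 mulmx1 mul1mx.
- by rewrite /reg_act mul1g inE -(inj_eq (@subg_inj _ G)) ?morph1 // subgK //.
- by exists (sgval t); rewrite ?subgP // /reg_act mul1g sgvalK.
Qed.

Section Minimal.
Variables (m : nat) (M : mx_representation k G m) (P : resolution M).
Hypothesis minP : minimal P.
Local Notation PP t := (GMod (rmod P t)).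

(** A hom from P t to a simple module kills the boundaries: otherwise its kernel
    would be a proper submodule with the same image in the syzygy. *)
Lemma minimal_cocycle N t (u : 'M[k]_(rdim P t, gdim N)) :
  (forall U : 'M[k]_(gdim N), mxmodule N U -> U = 0 \/ row_full U) ->
  @ghom _ _ _ (PP t) N u -> rdif P t *m u = 0.
Proof.
move=> simN hu.
have [b [e [ess ker_e]]] : exists b (e : 'M[k]_(rdim P t, b)),
    essential (rmod P t) e /\ rdif P t *m e = 0.
  case: t u hu => [|t] u hu.
    exists m, (raug P); split; first by case: minP.
    by apply/sub_kermxP; case/andP: (rdif_exact0 P).
  exists (rdim P t), (rdif P t); split; first by case: minP.
  by apply/sub_kermxP; case/andP: (rdif_exact P t).
have modV : mxmodule N <<rdif P t *m u>>%MS.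
  rewrite (eqmx_module _ (genmxE _)); apply/mxmoduleP => x Gx.
  have /homGP/(_ x Gx) hd := rdif_hom P t.
  by rewrite -mulmxA -hu // mulmxA -hd -mulmxA submxMl.
case: (simN _ modV) => [V0|fV].
  by apply/eqP; rewrite -submx0 -V0 genmxE.
have /submxP[y yE] : (u <= rdif P t *m u)%MS by rewrite -(genmxE (_ *m u)) submx_full.
have modK : mxmodule (rmod P t) (kermx u).
  by apply/mxmoduleP => x Gx; apply/sub_kermxP; rewrite -mulmxA hu // mulmxA mulmx_ker mul0mx.
have /(ess _ modK)/row_fullP[w wK] : (e <= kermx u *m e)%MS.
  have {1}-> : e = (1%:M - y *m rdif P t) *m e.
    by rewrite mulmxBl mul1mx -mulmxA ker_e mulmx0 subr0.
  by apply: submxMr; apply/sub_kermxP; rewrite mulmxBl mul1mx -mulmxA -yE subrr.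
by rewrite -[u]mul1mx -wK -[w *m _ *m u]mulmxA mulmx_ker !mulmx0.
Qed.

Lemma minimal_sdim N t :
  (forall U : 'M[k]_(gdim N), mxmodule N U -> U = 0 \/ row_full U) ->
  hdim (PP t.+1) N = sdim (syz P t.+1) N.
Proof.
move=> simN; rewrite -dim_Ext_sdim /dim_Ext.
have -> : (homG (rmod P t.+1) N :&: lker (linfun (mulmx (rdif P t.+1))))%VS = homG (PP t.+1) N.
  apply/capv_idPl/subvP => u /(@memh _ _ _ (PP t.+1)) hu.
  by rewrite memv_ker lfunE /= (minimal_cocycle simN hu).
have -> : (linfun (mulmx (rdif P t)) @: homG (rmod P t) N = 0)%VS.
  apply/eqP; rewrite -subv0; apply/subvP => _ /memv_imgP[u /(@memh _ _ _ (PP t)) hu ->].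
  by rewrite memv0 lfunE /= (minimal_cocycle simN hu).
by rewrite dimv0 subn0.
Qed.

(** For a simple module N the complex Hom(P, N) has zero differentials, so Ext^t
    bounds Hom(P t, N). Left exactness extends the bound to all modules N, and
    Hom(P t, kG) has the dimension of P t. *)
Lemma minimal_grows c :
  grows (rdim P) c <-> (forall N, grows (fun t => sdim (syz P t) N) c).
Proof.
split=> [gP N|gN].
  apply: grows_le (growsM (gdim N) gP) => -[//|t] _.
  apply: leq_trans (leq_trans (sdim_hdim _ _) (hdim_leq _ _)) _.
  by rewrite mulnC leq_mul2l /= mxrank_gen rank_leq_row orbT.
suff H N : grows (fun t => hdim (PP t) N) c.
  by apply: grows_le (H (regmod k G)) => t _; rewrite hdim_regmod.
have [n] := ubnP (gdim N); elim: n N => // n IHn N ltNn.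
have [[U [modU [U0 Uf]]]|simN] :=
  pselect (exists U : 'M[k]_(gdim N), mxmodule N U /\ (U <> 0 /\ ~ row_full U)).
  have [S [D [f [g [fg fE]]]]] := submodule_ses modU.
  have rS : gdim S = \rank U.
    rewrite -fE; case: fg => _ _ [r [s [fr _ _ _ _]]]; apply/esym/eqP.
    by rewrite -/(row_free f); apply/row_freeP; exists r.
  have rN := ses_gdim fg.
  have Upos : (0 < \rank U)%N by rewrite lt0n mxrank_eq0; apply/eqP.
  have Ulow : (\rank U < gdim N)%N by rewrite ltn_neqAle rank_leq_row andbT; apply/negP.
  apply: grows_le (growsD (IHn S _) (IHn D _)) => [t _||].
  - exact: hdim_left_exact fg _.
  - by rewrite rS; lia.
  - by lia.
apply: grows_le (gN N) => -[//|t] _; rewrite minimal_sdim // => U modU.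
case: (eqVneq U 0) => [->|/eqP U0]; first by left.
by right; apply/negPn/negP => fU; apply: simN; exists U; do !split=> //; apply/negP.
Qed.

End Minimal.
End ChainGrowth.

(** * Words as tabloids *)

Section WordCombinatorics.
Local Open Scope nat_scope.

Lemma sum_pow2 m : \sum_(j < m) 2 ^ j = 2 ^ m - 1.
Proof.
elim: m => [|m IHm]; first by rewrite big_ord0.
by rewrite big_ord_recr /= IHm expnS; have := expn_gt0 2 m; lia.
Qed.

Section DistinctPowers.
Variables (T : finType) (c : T -> nat).
Implicit Type S : {set T}.

Lemma sum_pow2_le S m : {in S &, injective c} -> (forall x, x \in S -> c x < m) ->
  \sum_(x in S) 2 ^ c x <= 2 ^ m - 1.
Proof.
case: m => [|m] c_inj c_lt.
  by rewrite big1 // => x /c_lt.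
pose d x : 'I_m.+1 := inord (c x).
have dE x : x \in S -> d x = c x :> nat by move=> /c_lt lt; rewrite inordK.
rewrite -sum_pow2 (eq_bigr (fun x => 2 ^ d x)) => [|x Sx]; last by rewrite dE.
rewrite -(big_imset (fun j : 'I_m.+1 => 2 ^ j)) /= => [|x y Sx Sy E].
  by rewrite [X in _ <= X](bigID (mem (d @: S))) leq_addr.
by apply: c_inj => //; rewrite -!dE // E.
Qed.

(** A sum of distinct powers of 2 is least for the smallest possible exponents. *)
Lemma sum_pow2_ge S : {in S &, injective c} ->
  2 ^ #|S| - 1 <= \sum_(x in S) 2 ^ c x /\
  (\sum_(x in S) 2 ^ c x <= 2 ^ #|S| - 1 -> forall x, x \in S -> c x < #|S|).
Proof.
have [m] := ubnP #|S|; elim: m S => // m IHm S ltSm c_inj.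
have [->|[x0 Sx0]] := set_0Vmem S.
  by rewrite cards0 big_set0; split=> // _ x; rewrite inE.
case: (arg_maxnP c Sx0) => x Sx' max_x'; pose R := S :\ x.
have {Sx'}Sx : x \in S by [].
have {max_x'}max_x y : y \in S -> c y <= c x := max_x' y.
have cS : #|S| = #|R|.+1 by rewrite (cardsD1 x) Sx.
have [||geR _] := IHm R; first by rewrite -ltnS -cS.
  by move=> y z /setD1P[_ Sy] /setD1P[_ Sz]; apply: c_inj.
have cx : #|R| <= c x.
  pose d y : 'I_(c x).+1 := inord (c y).
  have dE y : y \in S -> d y = c y :> nat by move=> /max_x le; rewrite inordK ?ltnS.
  rewrite -ltnS -cS -(card_ord (c x).+1) -(card_in_imset (f := d)) ?max_card //.
  by move=> y z Sy Sz E; apply: c_inj => //; rewrite -(dE y) // -(dE z) // E.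
rewrite (big_setD1 x Sx) -/R cS expnS /=.
have px : 2 ^ #|R| <= 2 ^ c x by rewrite leq_exp2l.
have p0 := expn_gt0 2 #|R|; split; first by lia.
move=> le y Sy; rewrite ltnS; apply: leq_trans (max_x y Sy) _.
by rewrite -(leq_exp2l (m := 2)) //; lia.
Qed.

End DistinctPowers.

Section Words.
Variable n : nat.
Definition word := {ffun 'I_n -> 'I_n.+1}.
Implicit Types (u v w : word) (g s : 'S_n) (i : 'I_n.+1) (x y : 'I_n).

Definition wact w g : word := [ffun x => w (g^-1%g x)].

Lemma wact1 w : wact w 1%g = w.
Proof. by apply/ffunP => x; rewrite ffunE invg1 perm1. Qed.

Lemma wactM w g s : wact w (g * s)%g = wact (wact w g) s.
Proof. by apply/ffunP => x; rewrite !ffunE invMg permM. Qed.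

(** A word is a tabloid: the letters are rows and the positions are entries, position
    x lying in row w x. Then colw w x is the column of x in the tableau with
    increasing rows, and phi replaces the dominance order on shapes. *)
Definition cnt w i := #|[set x | w x == i]|.
Definition colw w x := #|[set y : 'I_n | (y < x) && (w y == w x)]|.
Definition phi w := \sum_i (2 ^ cnt w i - 1).

Lemma cnt_wact w g i : cnt (wact w g) i = cnt w i.
Proof.
rewrite /cnt -(card_imset (mem [set x | w x == i]) (@perm_inj _ g)).
apply: eq_card => x; rewrite !inE ffunE; apply/idP/imsetP => [E|[y]].
  by exists (g^-1%g x); rewrite ?inE // permKV.
by rewrite inE => E ->; rewrite permK.
Qed.

Lemma phi_wact w g : phi (wact w g) = phi w.
Proof. by apply: eq_bigr => i _; rewrite cnt_wact. Qed.

Lemma colw_lt w x : colw w x < cnt w (w x).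
Proof.
apply: proper_card; apply/properP; split.
  by apply/subsetP => y; rewrite !inE => /andP[].
by exists x; rewrite !inE ?eqxx // ltnn.
Qed.

Lemma cell_inj w x y : w x = w y -> colw w x = colw w y -> x = y.
Proof.
move=> wxy; wlog lt : x y wxy / x < y => [IH|] E.
  by case: (ltngtP x y) => [/IH->|/IH->|/val_inj].
suff : colw w x < colw w y by rewrite E ltnn.
apply: proper_card; apply/properP; split.
  by apply/subsetP => z; rewrite !inE wxy => /andP[/ltn_trans->].
by exists x; rewrite !inE ?ltnn // lt wxy eqxx.
Qed.

Lemma cell_surj w i j : j < cnt w i -> exists x, w x = i /\ colw w x = j.
Proof.
move=> ltj; pose S := [set x | w x == i].
have [m cE] : exists m, #|S| = m.+1.
  by exists #|S|.-1; rewrite prednK //; apply: leq_ltn_trans ltj.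
pose d x : 'I_m.+1 := inord (colw w x).
have dE x : x \in S -> d x = colw w x :> nat.
  rewrite inE => /eqP wx; rewrite inordK // -cE.
  by have := colw_lt w x; rewrite wx.
have : d @: S = setT.
  apply/eqP; rewrite eqEcard subsetT cardsT card_ord card_in_imset ?cE ?ltnSn //.
  move=> x y Sx Sy /(congr1 val); rewrite /= !dE // => E; apply: (cell_inj _ E).
  by move: Sx Sy; rewrite !inE => /eqP-> /eqP->.
have ltm : j < m.+1 by rewrite -cE.
move/setP/(_ (Ordinal ltm)); rewrite inE => /imsetP[x Sx E]; exists x.
by rewrite -dE // -E; move: Sx; rewrite inE => /eqP.
Qed.

(** Placing each position x in row v x and column c' x, inside the diagram of w and
    in distinct cells, permutes the placement by w and colw w. *)
Lemma cells_perm w v (c' : 'I_n -> nat) :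
  (forall x, c' x < cnt w (v x)) ->
  (forall x y, v x = v y -> c' x = c' y -> x = y) ->
  exists s : 'S_n, forall x, w (s x) = v x /\ colw w (s x) = c' x.
Proof.
move=> lt inj; have /fin_all_exists[t tP] x := cell_surj (lt x).
have t_inj : injective t.
  move=> x y E; have [[vx cx] [vy cy]] := (tP x, tP y).
  by apply: inj; rewrite -?vx -?cx E.
by exists (perm t_inj) => x; rewrite permE.
Qed.

Lemma orbit_cnt w v : (forall i, cnt v i = cnt w i) -> exists g, v = wact w g.
Proof.
move=> E; have [x|x y|s sP] := @cells_perm w v (colw v).
- by rewrite -E; apply: colw_lt.
- exact: cell_inj.
by exists s^-1%g; apply/ffunP => x; rewrite ffunE invgK (sP x).1.
Qed.

Definition col_inj (c : 'I_n -> nat) v := forall x y, v x = v y -> c x = c y -> x = y.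

Lemma col_injPn (c : 'I_n -> nat) v : ~ col_inj c v ->
  exists x y, [/\ v x = v y, c x = c y & x != y].
Proof.
move=> ninj; apply: contrapT => none; apply: ninj => x y vxy cxy.
by apply/eqP/negPn/negP => xy; apply: none; exists x, y.
Qed.

Lemma phi_sum_rows (c : 'I_n -> nat) v :
  \sum_x 2 ^ c x = \sum_i \sum_(x in [set x | v x == i]) 2 ^ c x.
Proof.
rewrite (partition_big v predT) //=; apply: eq_bigr => i _.
by apply: eq_bigl => x; rewrite inE.
Qed.

(** If no two positions of the same row share a column, the columns met by a row
    are distinct, and the sum of 2 ^ c over a row of length r is at least
    2 ^ r - 1. So the shape of v cannot exceed that of w when c = colw w, and
    equality forces v to fill the diagram of w. *)
Lemma phi_le_cols (c : 'I_n -> nat) v : col_inj c v -> phi v <= \sum_x 2 ^ c x.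
Proof.
move=> ci; rewrite (phi_sum_rows c v); apply: leq_sum => i _.
apply: (sum_pow2_ge _).1 => x y; rewrite !inE => /eqP vx /eqP vy.
by apply: ci; rewrite vx vy.
Qed.

Lemma phi_cols w : phi w = \sum_x 2 ^ colw w x.
Proof.
apply/eqP; rewrite eqn_leq phi_le_cols; last exact: cell_inj.
rewrite (phi_sum_rows _ w); apply: leq_sum => i _; apply: sum_pow2_le => [x y|x].
  by rewrite !inE => /eqP wx /eqP wy; apply: cell_inj; rewrite wx wy.
by rewrite inE => /eqP <-; apply: colw_lt.
Qed.

Lemma col_inj_full (c : 'I_n -> nat) v : col_inj c v -> phi v = \sum_x 2 ^ c x ->
  forall x, c x < cnt v (v x).
Proof.
move=> ci; rewrite (phi_sum_rows c v) => E x.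
pose S i := [set x | v x == i]; pose r i := \sum_(x in S i) 2 ^ c x.
have rowP i : 2 ^ #|S i| - 1 <= r i /\
    (r i <= 2 ^ #|S i| - 1 -> forall x, x \in S i -> c x < #|S i|).
  by apply: sum_pow2_ge => y z; rewrite !inE => /eqP vy /eqP vz; apply: ci; rewrite vy vz.
have := (rowP (v x)).2; rewrite /cnt; apply; last by rewrite inE.
rewrite -(leq_add2r (\sum_(i | i != v x) r i)).
have <- : phi v = r (v x) + \sum_(i | i != v x) r i by rewrite E (bigD1 (v x)).
rewrite /phi (bigD1 (v x)) //= leq_add2l; apply: leq_sum => i _.
exact: (rowP i).1.
Qed.

(** The ballot form of standardness: every initial segment of positions meets a row
    at least as often as any later row. It implies that columns increase. *)
Definition pre w y i := #|[set z : 'I_n | (z <= y) && (w z == i)]|.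
Definition standard w :=
  [forall y : 'I_n, forall i : 'I_n.+1, forall i' : 'I_n.+1,
    (i < i') ==> (pre w y i' <= pre w y i)].

Lemma standard_col w x y : standard w -> colw w x = colw w y -> w x < w y -> x < y.
Proof.
move=> std cxy wxy; case: (ltngtP x y) => // [yx|/val_inj xy]; last first.
  by move: wxy; rewrite xy ltnn.
have := std; move=> /forallP/(_ y)/forallP/(_ (w x))/forallP/(_ (w y)).
rewrite wxy /= leqNgt; case/negP.
apply: (@leq_ltn_trans (colw w x)).
  apply: subset_leq_card; apply/subsetP => z; rewrite !inE => /andP[zy ->].
  by rewrite (leq_ltn_trans zy yx).
rewrite cxy; apply: proper_card; apply/properP; split.
  by apply/subsetP => z; rewrite !inE => /andP[/ltnW-> ->].
by exists y; rewrite !inE ?leqnn ?eqxx // ltnn.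
Qed.

Definition ltw v u :=
  [exists x : 'I_n, (v x < u x) && [forall y : 'I_n, (y < x) ==> (v y == u y)]].

Lemma ltwP v u :
  reflect (exists x, v x < u x /\ forall y, y < x -> v y = u y) (ltw v u).
Proof.
apply: (iffP existsP) => [[x /andP[lt /forallP E]]|[x [lt E]]]; exists x.
  by split=> // y yx; apply/eqP; have := E y; rewrite yx.
by rewrite lt; apply/forallP => y; apply/implyP => /E ->.
Qed.

Lemma ltw_irr u : ltw u u = false.
Proof. by apply/ltwP => -[x []]; rewrite ltnn. Qed.

Lemma ltw_trans u v w : ltw u v -> ltw v w -> ltw u w.
Proof.
move=> /ltwP[x [uv Ex]] /ltwP[y [vw Ey]]; apply/ltwP.
case: (ltngtP x y) => [xy|yx|/val_inj xy].
- by exists x; rewrite -Ey //; split=> // z zx; rewrite Ex // Ey // (ltn_trans zx).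
- by exists y; rewrite Ex //; split=> // z zy; rewrite -Ey // Ex // (ltn_trans zy).
- subst y; exists x; split; first exact: ltn_trans vw.
  by move=> z zx; rewrite Ex // Ey.
Qed.

Lemma ltw_ind (P : word -> Prop) :
  (forall u, (forall v, ltw v u -> P v) -> P u) -> forall u, P u.
Proof.
move=> IH u; pose r u := #|[set v | ltw v u]|.
have [m] := ubnP (r u); elim: m u => // m IHm u ltm.
apply: IH => v vu; apply: IHm; rewrite -ltnS; apply: leq_trans ltm.
rewrite ltnS; apply: proper_card; apply/properP; split.
  by apply/subsetP => w; rewrite !inE => /ltw_trans; apply.
by exists v; rewrite !inE ?vu // ltw_irr.
Qed.

Lemma gtw_ind (P : word -> Prop) :
  (forall u, (forall v, ltw u v -> P v) -> P u) -> forall u, P u.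
Proof.
move=> IH u; pose r u := #|[set v | ltw u v]|.
have [m] := ubnP (r u); elim: m u => // m IHm u ltm.
apply: IH => v uv; apply: IHm; rewrite -ltnS; apply: leq_trans ltm.
rewrite ltnS; apply: proper_card; apply/properP; split.
  by apply/subsetP => w; rewrite !inE => /(ltw_trans uv).
by exists v; rewrite !inE ?uv // ltw_irr.
Qed.

Lemma first_difference u v : u <> v ->
  exists x, u x <> v x /\ forall y, y < x -> u y = v y.
Proof.
move=> ne; case: (pickP (fun x => u x != v x)) => [x0 ne0|E]; last first.
  by case: ne; apply/ffunP => x; have /negbFE/eqP := E x.
case: (@arg_minnP _ x0 (fun x => u x != v x) (fun x : 'I_n => x : nat) ne0) => x ne_x min_x.
exists x; split; first exact/eqP.
move=> y yx; apply/eqP; apply: contraTT yx => /min_x; rewrite -leqNgt //.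
Qed.

(** Columns of a standard word increase, so at the first position that changes the
    letter coming from later in the column is larger. *)
Lemma standard_col_perm w s : standard w ->
  (forall x, colw w (s x) = colw w x) -> wact w s <> w -> ltw w (wact w s).
Proof.
move=> std cs /first_difference[x []]; rewrite ffunE => ne E; apply/ltwP.
exists x; split; last by move=> y /E.
rewrite ffunE; set z := s^-1%g x in ne *; have sz : s z = x by rewrite permKV.
have czx : colw w z = colw w x by rewrite -sz cs.
case: (ltngtP (w z) (w x)) => [lt|//|/val_inj //].
have zx := standard_col std czx lt.
have wz : w (s^-1%g z) = w z by rewrite -(E z zx) ffunE.
have : s^-1%g z = z by apply: (cell_inj wz); rewrite -[in RHS](permKV s z) cs.
by rewrite {2}/z => /perm_inj E'; move: lt; rewrite E' ltnn.
Qed.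

End Words.

Section Straightening.
Variable n : nat.
Implicit Types (u v w : word n) (g s : 'S_n) (i : 'I_n.+1) (x y : 'I_n).

Definition shape_sorted w := forall i i', i < i' -> cnt w i' <= cnt w i.

(** There is one letter more than there are positions, to leave room for a new row. *)
Lemma fresh_letter u : exists l, cnt u l = 0.
Proof.
case: (pickP (fun l => l \notin [set u x | x : 'I_n])) => [l Hl|E].
  exists l; apply/eqP; rewrite cards_eq0 -subset0; apply/subsetP => x.
  by rewrite !inE => /eqP E; move: Hl; rewrite -E imset_f.
have : #|[set u x | x : 'I_n]| = n.+1.
  rewrite -[RHS]card_ord -cardsT; congr #|pred_of_set _|; apply/setP => l.
  by rewrite inE; apply/negPn; rewrite E.
by move=> C; have := leq_imset_card u 'I_n; rewrite C card_ord ltnn.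
Qed.

(** Garnir straightening. If the positions up to y0 meet row i' more often than the
    earlier row i, then the positions of row i' up to y0 and those of row i beyond
    y0 form a set X with more elements than row i. Let w' have the row X, the
    rest of row i in a new row, and the other positions where they were; the words
    related to w' are those that distribute X over the rows i and i'. Among those
    of the shape of u, the word u is the lexicographically largest, because it has
    the letter i' on the smallest elements of X. *)
Lemma straighten u : shape_sorted u -> ~~ standard u ->
  exists (w' : word n) (r : word n -> word n -> bool),
  [/\ phi u < phi w', forall v u' g, r (wact v g) (wact u' g) = r v u', r w' u &
      forall u', (forall i, cnt u' i = cnt u i) -> r w' u' -> u' <> u -> ltw u' u].
Proof.
move=> srt; rewrite negb_forall => /existsP[y0]; rewrite negb_forall => /existsP[i].
rewrite negb_forall => /existsP[i']; rewrite negb_imply -ltnNge => /andP[ii' ltpre].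
have [fr fr0] := fresh_letter u.
have ufr x : u x != fr.
  apply/eqP => E; have : x \in [set x | u x == fr] by rewrite inE E.
  by rewrite (cards0_eq fr0) inE.
have i'i : (i' == i) = false by apply/eqP => E; rewrite E ltnn in ii'.
have ci : 0 < cnt u i.
  apply: leq_trans (srt _ _ ii'); apply: leq_ltn_trans (leq0n (pre u y0 i)) _.
  apply: leq_trans ltpre _; apply: subset_leq_card; apply/subsetP => z.
  by rewrite !inE => /andP[].
have ifr : (i == fr) = false.
  by apply/eqP => E; rewrite E fr0 in ci.
pose X := [set x : 'I_n | (x <= y0) && (u x == i') || (y0 < x) && (u x == i)].
pose w' : word n := [ffun x => if x \in X then i else if u x == i then fr else u x].
pose r (v u' : word n) := [forall x, if v x == fr then u' x == i
  else if v x == i then (u' x == i) || (u' x == i') else u' x == v x].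
have w'u u' : r w' u' -> forall x, if x \in X then (u' x == i) || (u' x == i')
    else u' x == u x.
  move=> /forallP R x; move: (R x); rewrite ffunE; case: (x \in X).
    by rewrite ifr eqxx.
  by case: (eqVneq (u x) i) => [->|ne]; rewrite ?eqxx // (negPf (ufr x)) (negPf ne).
exists w', r; split.
- have cX : cnt u i < #|X|.
    have -> : #|X| = pre u y0 i' + #|[set x : 'I_n | (y0 < x) && (u x == i)]|.
      rewrite -cardsUI (_ : _ :&: _ = set0) ?cards0 ?addn0.
        by apply: eq_card => x; rewrite !inE.
      by apply/setP => x; rewrite !inE; case: ltnP => //=; rewrite ?andbF.
    have -> : cnt u i = pre u y0 i + #|[set x : 'I_n | (y0 < x) && (u x == i)]|.
      rewrite -cardsUI (_ : _ :&: _ = set0) ?cards0 ?addn0.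
        by apply: eq_card => x; rewrite !inE; case: leqP => _; rewrite ?orbF.
      by apply/setP => x; rewrite !inE; case: ltnP => //=; rewrite ?andbF.
    by rewrite ltn_add2r.
  have cw' : cnt w' i = #|X|.
    apply: eq_card => x; rewrite [LHS]inE ffunE.
    case: (x \in X) => /=; first by rewrite eqxx.
    by case: (eqVneq (u x) i) => [_|/negPf -> //]; rewrite eq_sym ifr.
  have rest : \sum_(l | (l != i) && (l != i')) (2 ^ cnt u l - 1) <=
      \sum_(l | (l != i) && (l != i')) (2 ^ cnt w' l - 1).
    apply: leq_sum => l /andP[li li']; apply: leq_sub2r; rewrite leq_exp2l //.
    apply: subset_leq_card; apply/subsetP => x; rewrite !inE ffunE => /eqP ux.
    rewrite ifN; first by rewrite ux (negPf li).
    by rewrite inE ux (negPf li) (negPf li') !andbF.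
  have pi' : 2 ^ cnt u i' <= 2 ^ cnt u i by rewrite leq_exp2l // srt.
  have pi : 2 ^ (cnt u i).+1 <= 2 ^ cnt w' i by rewrite leq_exp2l // cw'.
  have p0 := expn_gt0 2 (cnt u i); rewrite expnS in pi.
  have -> : phi u = 2 ^ cnt u i - 1 + (2 ^ cnt u i' - 1 +
      \sum_(l | (l != i) && (l != i')) (2 ^ cnt u l - 1)).
    by rewrite /phi (bigD1 i) //= (bigD1 i') ?i'i.
  have -> : phi w' = 2 ^ cnt w' i - 1 + (2 ^ cnt w' i' - 1 +
      \sum_(l | (l != i) && (l != i')) (2 ^ cnt w' l - 1)).
    by rewrite /phi (bigD1 i) //= (bigD1 i') ?i'i.
  move: rest pi pi' p0; move: (\sum_(l | _) _) (\sum_(l | _) _) => a b.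
  move: (2 ^ _) (2 ^ _) (2 ^ _) (2 ^ _) => c d e f; lia.
- move=> v u' g; apply/forallP/forallP => R x; last by rewrite !ffunE; apply: R.
  by have := R (g x); rewrite !ffunE permK.
- apply/forallP => x; rewrite ffunE; case: (boolP (x \in X)) => [|xX].
    by rewrite ifr eqxx inE => /orP[]/andP[_ ->]; rewrite ?orbT.
  by case: (eqVneq (u x) i) => [->|ne]; rewrite ?eqxx // (negPf (ufr x)) (negPf ne).
- move=> u' cu' /w'u R ne.
  have [x [xy0 uxi' u'xi]] : exists x, [/\ x <= y0, u x = i' & u' x = i].
    case: (pickP (fun x => [&& x <= y0, u x == i' & u' x == i])) => [x|none].
      by case/and3P => ? /eqP ? /eqP ?; exists x.
    have sub : [set x | u' x == i] \subset [set x | u x == i].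
      apply/subsetP => x; rewrite !inE => u'x; have := none x; have := R x.
      rewrite inE u'x; case: ifP => [/orP[]/andP[xy ux] _|_ /eqP <- //].
        by rewrite xy ux.
      by [].
    have eqi : [set x | u' x == i] = [set x | u x == i].
      by apply/eqP; rewrite eqEcard sub; have := cu' i; rewrite /cnt => -> /=.
    case: ne; apply/ffunP => x; have := R x; have := none x.
    case: ifP => [|_ _ /eqP //]; rewrite inE => /orP[]/andP[xy /eqP ux].
      by rewrite xy ux eqxx /= => -> /eqP.
    by move=> _ _; move/setP/(_ x): eqi; rewrite !inE ux eqxx => /eqP.
  have [z [nez minz]] := first_difference ne.
  have zx : z <= x.
    rewrite leqNgt; apply/negP => /minz; rewrite u'xi uxi' => E.
    by rewrite E eqxx in i'i.
  have zy0 := leq_trans zx xy0.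
  apply/ltwP; exists z; split; last exact: minz.
  move: (R z); case: ifP => [|_ /eqP E]; last by case: nez.
  rewrite inE zy0 /= ltnNge zy0 orbF => /eqP uz /orP[/eqP ->|/eqP E]; first by rewrite uz.
  by case: nez; rewrite E uz.
Qed.

End Straightening.

End WordCombinatorics.

(** * Specht modules *)

Section WordModules.
Variables (k : fieldType) (n : nat).
Local Notation S := [set: 'S_n]%G.
Implicit Types (u v w : word n) (g s : 'S_n) (A B M N : gmod k S).

(** The orbit of w, on which the permutation module is M^lambda for lambda the
    shape of w. *)
Definition worb w := {v : word n | [exists g, v == wact w g]}.

Lemma oact_subproof w (t : worb w) g : [exists h, wact (val t) g == wact w h].
Proof.
by have /existsP[h /eqP ->] := valP t; apply/existsP; exists (h * g)%g; rewrite wactM.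
Qed.
Definition oact w (t : worb w) g : worb w :=
  exist (fun v => [exists h, v == wact w h]) (wact (val t) g) (oact_subproof t g).

Lemma oact1 w (t : worb w) : oact t 1%g = t.
Proof. by apply: val_inj; rewrite /= wact1. Qed.

Lemma oactM w : {in S &, forall g s (t : worb w), oact t (g * s)%g = oact (oact t g) s}.
Proof. by move=> g s _ _ t; apply: val_inj; rewrite /= wactM. Qed.

Definition wmod w : gmod k S := permmod k (@oact1 w) (@oactM w).

Lemma base_subproof w : [exists g, w == wact w g].
Proof. by apply/existsP; exists 1%g; rewrite wact1. Qed.
Definition base w : worb w := exist (fun v => [exists h, v == wact w h]) w (base_subproof w).

Lemma base_trans w (t : worb w) : exists g, t = oact (base w) g.
Proof.
by have /existsP[g /eqP E] := valP t; exists g; apply: val_inj; rewrite /= E.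
Qed.

Local Notation b t := ('e_(enum_rank t) : 'rV[k]_#|{: worb _}|).

Definition orthogonal_mod M := forall g, (M g)^T = M g^-1%g.

Lemma wmod_orthogonal w : orthogonal_mod (wmod w).
Proof. by move=> g; apply: permmod_orthogonal; rewrite inE. Qed.

Lemma wmod_basis w (t : worb w) g : b t *m wmod w g = b (oact t g).
Proof. exact: permmod_basis. Qed.

Section ColumnSum.
Variable c : 'I_n -> nat.

Definition colstab s := [forall x, c (s x) == c x].
Definition colsum M : 'M[k]_(gdim M) := \sum_(s | colstab s) (-1) ^+ s *: M s.

Lemma colstabP s : reflect (forall x, c (s x) = c x) (colstab s).
Proof. by apply: (iffP forallP) => E x; apply/eqP; apply: E. Qed.

Lemma basis_colsum w (t : worb w) :
  b t *m colsum (wmod w) = \sum_(s | colstab s) (-1) ^+ s *: b (oact t s).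
Proof.
by rewrite /colsum mulmx_sumr; apply: eq_bigr => s _; rewrite -scalemxAr wmod_basis.
Qed.

Lemma colsum_hom A B f : @ghom _ _ _ A B f -> colsum A *m f = f *m colsum B.
Proof.
move=> hf; rewrite /colsum mulmx_suml mulmx_sumr; apply: eq_bigr => s _.
by rewrite -scalemxAl -scalemxAr hf // inE.
Qed.

Lemma colsum_tr M : orthogonal_mod M -> (colsum M)^T = colsum M.
Proof.
move=> oM; rewrite /colsum [LHS](raddf_sum (@trmx _ _ _)).
rewrite [LHS](reindex_inj invg_inj); apply: eq_big => [s|s _].
  apply/colstabP/colstabP => E x; first by rewrite -[in RHS](permK s x) E.
  by rewrite -[in RHS](permKV s x) E.
by rewrite /= linearZ /= oM invgK odd_permV.
Qed.

Lemma colsum_sub m M (U : 'M_(m, gdim M)) : mxmodule M U -> (U *m colsum M <= U)%MS.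
Proof.
move=> modU; rewrite /colsum mulmx_sumr summx_sub // => s _.
by rewrite -scalemxAr scalemx_sub // (mxmoduleP modU) ?inE.
Qed.

Lemma colsum_repeat w (t : worb w) x y :
  x != y -> c x = c y -> val t x = val t y -> b t *m colsum (wmod w) = 0.
Proof.
move=> xy cxy txy; pose tau := tperm x y.
have tt : oact t tau = t.
  apply: val_inj; apply/ffunP => z; rewrite ffunE tpermV.
  by rewrite /tau; case: tpermP => [->|->|].
have ctau s : colstab (tau * s)%g = colstab s.
  have ct z : c (tau z) = c z by rewrite /tau; case: tpermP => [->|->|].
  apply/colstabP/colstabP => E z; last by rewrite permM E ct.
  have -> : s z = (tau * s)%g (tau z) by rewrite permM tpermK.
  by rewrite E ct.
(* The terms of s and of tau * s are opposite; pairing them, rather than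
   comparing the sum with its opposite, is what works in characteristic 2. *)
rewrite basis_colsum (bigID (fun s : 'S_n => odd_perm s)) (reindex_inj (mulgI tau)) /=.
rewrite -[RHS](addNr (\sum_(s | colstab s && ~~ odd_perm s) (-1) ^+ s *: b (oact t s))).
congr (_ + _); rewrite -sumrN.
apply: eq_big => [s|s _]; first by rewrite ctau odd_permM odd_tperm xy.
by rewrite oactM ?inE // tt odd_permM odd_tperm xy signrN scaleNr.
Qed.

End ColumnSum.

Definition polytabloid w (t : worb w) : 'rV[k]_#|{: worb w}| :=
  b t *m colsum (colw (val t)) (wmod w).

(** All polytabloids of a shape are translates of one. *)
Lemma polytabloid_trans w (t : worb w) :
  exists g, polytabloid t = polytabloid (base w) *m wmod w g.
Proof.
have cE i : cnt (val t) i = cnt w i by have [g ->] := base_trans t; rewrite cnt_wact.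
have [x|x y|s sP] := @cells_perm _ w (val t) (colw (val t)).
- by rewrite -cE; apply: colw_lt.
- exact: cell_inj.
have tE : t = oact (base w) s^-1%g.
  by apply: val_inj; apply/ffunP => x; rewrite ffunE invgK (sP x).1.
exists s^-1%g; rewrite /polytabloid !basis_colsum mulmx_suml.
rewrite (reindex_inj (conjg_inj s^-1%g)); apply: eq_big => [h|h _].
  have sX y : s ((h ^ s^-1)%g y) = h (s y).
    by rewrite conjgE invgK !permM permKV.
  apply/colstabP/colstabP => E y; last by rewrite -!(sP _).2 sX.
  by have := E (s^-1%g y); rewrite -!(sP _).2 sX permKV.
rewrite -scalemxAl wmod_basis odd_permJ; congr (_ *: _).
rewrite {1}tE -!oactM ?inE //; congr (b (oact _ _)).
by rewrite conjgE mulKVg.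
Qed.

Section Specht.
Variable w : word n.
Local Notation W := (wmod w).
Local Notation d := #|{: worb w}|.
Local Notation kap := (colsum (colw w) W).
Local Notation e0 := (polytabloid (base w)).

(** A word with two positions of a row in the same column is killed by colsum; any
    other word of the same shape is w up to a column permutation, and is sent
    to a multiple of the polytabloid. *)
Lemma colsum_line : (kap <= e0)%MS.
Proof.
apply/row_subP => i; rewrite -(enum_valK i) rowE; move: (enum_val i) => t {i}.
have [inj|ninj] := pselect (col_inj (colw w) (val t)); last first.
  have [x [y [txy cxy xy]]] := col_injPn ninj.
  by rewrite (colsum_repeat xy cxy txy) sub0mx.
have cE i : cnt (val t) i = cnt w i by have [g ->] := base_trans t; rewrite cnt_wact.
have full := col_inj_full inj; rewrite -phi_cols in full.
have phiE : phi (val t) = phi w by apply: eq_bigr => i _; rewrite cE.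
have [x|x y|s sP] := @cells_perm _ w (val t) (colw w).
- by rewrite -cE; apply: full.
- exact: inj.
have tE : t = oact (base w) s^-1%g.
  by apply: val_inj; apply/ffunP => x; rewrite ffunE invgK (sP x).1.
apply/submxP; exists ((-1) ^+ s)%:M; rewrite mul_scalar_mx /polytabloid !basis_colsum.
rewrite scaler_sumr (reindex_inj (mulgI s)); apply: eq_big => [h|h _].
  apply/colstabP/colstabP => E x; last by rewrite permM E (sP x).2.
  have := E (s^-1%g x); rewrite permM permKV => ->.
  by have := (sP (s^-1%g x)).2; rewrite permKV => ->.
rewrite scalerA -signr_addb -odd_permM tE; congr (_ *: b _).
by rewrite -oactM ?inE // mulKg.
Qed.

(** By the bound on shapes every word of the larger shape repeats a column. *)
Lemma colsum_higher w' : (phi w < phi w')%N -> colsum (colw w) (wmod w') = 0.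
Proof.
move=> lt; apply/row_matrixP => i; rewrite row0 -(enum_valK i) rowE.
move: (enum_val i) => t {i}.
have phiE : phi (val t) = phi w'.
  by have [g ->] := base_trans t; rewrite phi_wact.
have ninj : ~ col_inj (colw w) (val t).
  by move=> /phi_le_cols; rewrite -phi_cols phiE leqNgt lt.
have [x [y [txy cxy xy]]] := col_injPn ninj.
exact: colsum_repeat xy cxy txy.
Qed.

Definition specht : 'M[k]_(#|{: 'S_n}|, d) := \matrix_i (e0 *m W (enum_val i)).
Definition specht_perp : 'M[k]_d := kermx specht^T.

Lemma specht_module : mxmodule W specht.
Proof.
apply/mxmoduleP => g _; apply/row_subP => i; rewrite row_mul rowK -mulmxA.
rewrite -repr_mxM ?inE //.
have -> : e0 *m W (enum_val i * g)%g = row (enum_rank (enum_val i * g)%g) specht.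
  by rewrite rowK enum_rankK.
exact: row_sub.
Qed.

Lemma specht_perpP m (U : 'M_(m, d)) :
  reflect (forall g, U *m (e0 *m W g)^T = 0) (U <= specht_perp)%MS.
Proof.
apply: (iffP sub_kermxP) => [U0 g|U0].
  have -> : e0 *m W g = row (enum_rank g) specht by rewrite rowK enum_rankK.
  by rewrite tr_row colE mulmxA U0 mul0mx.
apply: trmx_inj; apply/row_matrixP => i; rewrite trmx0 row0 -tr_col colE -mulmxA.
by rewrite -colE -tr_row rowK U0 trmx0.
Qed.

Lemma specht_perp_polytabloid m (U : 'M_(m, d)) (t : worb w) :
  (U <= specht_perp)%MS -> U *m (polytabloid t)^T = 0.
Proof. by move/specht_perpP => U0; have [g ->] := polytabloid_trans t. Qed.

Lemma specht_perp_module : mxmodule W specht_perp.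
Proof.
apply/mxmoduleP => g _; apply/specht_perpP => h.
have -> : specht_perp *m W g *m (e0 *m W h)^T = specht_perp *m (e0 *m W (h * g^-1)%g)^T.
  rewrite (repr_mxM W (in_setT h) (in_setT g^-1%g)) mulmxA [in RHS]trmx_mul.
  by rewrite wmod_orthogonal invgK mulmxA.
exact: (specht_perpP _ (submx_refl _)).
Qed.

Lemma hom_sub_specht_perp w' (f : 'M_(_, d)) : (phi w < phi w')%N ->
  @ghom _ _ _ (wmod w') W f -> (f <= specht_perp)%MS.
Proof.
move=> lt hf; apply/specht_perpP => g.
rewrite /polytabloid !trmx_mul (colsum_tr _ (@wmod_orthogonal w)) wmod_orthogonal.
rewrite !mulmxA -hf ?inE // -(mulmxA _ f) -(colsum_hom _ hf) colsum_higher //.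
by rewrite mul0mx mulmx0 mul0mx.
Qed.

(** James's submodule theorem. Since colsum maps the permutation module into the
    line of the polytabloid, either U contains the polytabloid or colsum kills U,
    and colsum is self-adjoint. *)
Lemma submodule_dichotomy (U : 'M_d) : mxmodule W U ->
  (specht <= U)%MS \/ (U <= specht_perp)%MS.
Proof.
move=> modU; case: (eqVneq (U *m kap) 0) => [U0|nz].
  right; apply/specht_perpP => g.
  rewrite /polytabloid !trmx_mul (colsum_tr _ (@wmod_orthogonal w)) wmod_orthogonal.
  have /submxP[y yE] := mxmoduleP modU g^-1%g (in_setT _).
  by rewrite !mulmxA yE -(mulmxA y) U0 mulmx0 mul0mx.
left; have line : (U *m kap <= e0)%MS by apply: submx_trans (submxMl _ _) colsum_line.
have e0U : (e0 <= U)%MS.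
  have /submx_trans : (e0 <= U *m kap)%MS; last by apply; exact: (@colsum_sub (colw w) _ W U).
  rewrite -(geq_leqif (mxrank_leqif_sup line)).
  by apply: leq_trans (rank_leq_row _) _; rewrite lt0n mxrank_eq0.
apply/row_subP => i; rewrite rowK; apply: submx_trans (submxMr _ e0U) _.
by apply: (mxmoduleP modU); rewrite inE.
Qed.

Lemma polytabloid_diag (t : worb w) : polytabloid t 0 (enum_rank t) = 1.
Proof.
rewrite /polytabloid basis_colsum summxE (bigD1 1%g) /=; last first.
  by apply/colstabP => x; rewrite perm1.
rewrite odd_perm1 scale1r oact1 mxE !eqxx big1 ?addr0 // => s /andP[/colstabP cs s1].
rewrite !mxE (inj_eq enum_rank_inj) andTb.
case: eqP => [E|_]; last by rewrite mulr0.
case/eqP: s1; apply/permP => x; rewrite perm1; apply: (@cell_inj _ (val t)); last exact: cs.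
by have /ffunP/(_ (s x)) := congr1 val (esym E); rewrite ffunE permK => ->.
Qed.

Lemma polytabloid_supp (t u : worb w) : standard (val t) ->
  polytabloid t 0 (enum_rank u) != 0 -> u = t \/ ltw (val t) (val u).
Proof.
move=> std nz; have [s cs uE] : exists2 s, colstab (colw (val t)) s & u = oact t s.
  apply: contrapT => none; case/eqP: nz; rewrite /polytabloid basis_colsum summxE big1 //.
  move=> s cs; rewrite !mxE (inj_eq enum_rank_inj) andTb.
  case: eqP => [E|_]; last by rewrite mulr0.
  by case: none; exists s.
have [->|ne] := eqVneq u t; [by left | right]; rewrite uE.
apply: standard_col_perm => //; first exact/colstabP.
by move=> E; case/eqP: ne; rewrite uE; apply: val_inj.
Qed.

End Specht.

End WordModules.

(** * Generation by permutation modules *)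

Section Generation.
Variables (k : fieldType) (n : nat).
Local Notation S := [set: 'S_n]%G.
Implicit Types (u v w : word n) (A B M N : gmod k S).
Local Notation b t := ('e_(enum_rank t) : 'rV[k]_#|{: worb _}|).

Section Relations.
Variables (w' w : word n) (r : word n -> word n -> bool).
Hypothesis r_inv : forall v u g, r (wact v g) (wact u g) = r v u.

Definition relmx : 'M[k]_(#|{: worb w'}|, #|{: worb w}|) :=
  \matrix_(i, j) (r (val (enum_val i)) (val (enum_val j)))%:R.

Lemma relmx_hom : @ghom _ _ _ (wmod k w') (wmod k w) relmx.
Proof.
apply/permmod_homP => g _ t; apply/rowP => j.
rewrite !mxE enum_rankK (bigD1 (enum_rank (oact (enum_val j) g^-1%g))) //=.
rewrite big1 ?addr0 => [|i ne_i].
  rewrite !mxE !enum_rankK -oactM ?inE // mulVg oact1 eqxx mulr1 /=.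
  by rewrite -(r_inv (sval t) _ g) -wactM mulVg wact1.
rewrite !mxE [_ == _](_ : _ = false) ?mulr0 //; apply: contraNF ne_i => /eqP ->.
by rewrite -oactM ?inE // mulgV oact1 enum_valK.
Qed.

Lemma row_relmx : row (enum_rank (base w')) relmx =
  \sum_(u : worb w | r w' (val u)) b u.
Proof.
apply/rowP => j; rewrite !mxE enum_rankK summxE /= big_mkcond (bigD1 (enum_val j)) //=.
rewrite big1 ?addr0 => [|u ne]; case: ifP => _ //; rewrite !mxE ?enum_valK ?eqxx //.
by rewrite -(enum_valK j) (inj_eq enum_rank_inj) eq_sym (negPf ne).
Qed.

End Relations.

Section Straightening.
Variable w : word n.
Local Notation d := #|{: worb w}|.
Local Notation O := (specht_perp k w).

(** Modulo f every word is a combination of standard ones, by descending along the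
    relations. An element of O that is supported on standard words is zero: pair
    it with the polytabloid of the lexicographically largest standard word t in
    its support, whose other terms are larger than t. *)
Lemma specht_perp_spanned p (f : 'M[k]_(p, d)) :
  (forall u : worb w, ~~ standard (val u) -> exists U : {pred worb w},
     [/\ u \in U, ((\sum_(u' in U) b u')%R <= f)%MS &
         forall u' : worb w, u' \in U -> u' != u -> ltw (val u') (val u)]) ->
  (f <= O)%MS -> (O <= f)%MS.
Proof.
move=> rel fO; pose st (i : 'I_d) := standard (val (enum_val i)).
pose Std : 'M[k]_d := \matrix_i (if st i then 'e_i else 0).
have spanb (u : worb w) : (b u <= f + Std)%MS.
  move: {2}(val u) (erefl (val u)) => v; move: v u; apply: ltw_ind => v IH u uE.
  case: (boolP (standard (val u))) => [std|/rel[U [uU sumU ltU]]].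
    apply: submx_trans (addsmxSr _ _).
    have -> : b u = row (enum_rank u) Std by rewrite rowK /st enum_rankK std.
    exact: row_sub.
  have -> : b u = \sum_(u' in U) b u' - \sum_(u' in U | u' != u) b u'.
    by rewrite (bigD1 u) //= addrK.
  rewrite addmx_sub ?(submx_trans sumU) ?addsmxSl // eqmx_opp summx_sub // => u' /andP[Uu' ne].
  by apply: (IH (val u')) => //; rewrite -uE ltU.
have /sub_addsmxP[[y c] /= OE] : (O <= f + Std)%MS.
  apply: (submx_trans (submx1 _)); apply/row_subP => i; rewrite row1 -(enum_valK i).
  exact: spanb.
pose z := c *m Std.
have zO : (z <= O)%MS.
  have -> : z = O - y *m f by rewrite OE addrC addKr.
  by rewrite addmx_sub // eqmx_opp mulmx_sub.
suff z0 : z = 0 by rewrite OE -/z z0 addr0 submxMl.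
apply/matrixP => i j; rewrite [RHS]mxE -(enum_valK j); move: (enum_val j) => {j}.
suff H v (u : worb w) : val u = v -> z i (enum_rank u) = 0 by move=> u; exact: (H _ u erefl).
move: v u; apply: gtw_ind => v IH u uE.
case: (boolP (standard (val u))) => std; last first.
  rewrite mxE big1 // => l _; rewrite mxE; case: ifP => [stl|_]; rewrite mxE ?mulr0 //.
  case: (eqVneq (enum_rank u) l) => [E|_]; rewrite ?andbF ?mulr0 //.
  by move: stl std; rewrite /st -E enum_rankK => ->.
have /matrixP/(_ i 0) := specht_perp_polytabloid u zO.
rewrite mxE (bigD1 (enum_rank u)) //= big1 => [|l ne]; last first.
  rewrite [_^T _ _]mxE -(enum_valK l); set u' := enum_val l.
  case: (eqVneq (polytabloid k u 0 (enum_rank u')) 0) => [->|nz]; first by rewrite mulr0.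
  have [E|lt] := polytabloid_supp std nz.
    by case/eqP: ne; rewrite -E /u' enum_valK.
  by rewrite (IH (val u')) ?mul0r // -uE.
by rewrite [_^T _ _]mxE polytabloid_diag mulr1 addr0 [RHS]mxE.
Qed.

End Straightening.

Variable T : gmod k S -> Prop.
Hypothesis tT : thick T.

(** Finitely many homs from hereditary modules combine into one, out of the direct
    sum. Orthogonality is kept so that the transpose of f is again a hom. *)
Lemma hered_family N (O : 'M[k]_(gdim N)) (I : eqType) (s : seq I)
    (v : I -> 'rV[k]_(gdim N)) :
  (forall i, i \in s -> exists A f, [/\ hered T A, orthogonal_mod A,
     @ghom _ _ _ A N f, (f <= O)%MS & (v i <= f)%MS]) ->
  exists A f, [/\ hered T A, orthogonal_mod A, @ghom _ _ _ A N f,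
     (f <= O)%MS & forall i, i \in s -> (v i <= f)%MS].
Proof.
elim: s => [|i s IHs] vs.
  exists (gzero k S), 0; split=> //; rewrite ?sub0mx //.
  - move=> X Y j q hj fj hq uq; apply: (thick_zero tT); apply: (full_gdim0 uq).
    by apply/eqP; rewrite -leqn0; move/eqP: fj => <-; exact: rank_leq_col.
  - by move=> g; apply/matrixP => -[].
  - exact: ghom0.
have [|A [f [sA oA hf fO fP]]] := IHs; first by move=> j js; apply: vs; rewrite inE js orbT.
have [B [g [sB oB hg gO gP]]] := vs i (mem_head _ _).
exists (gsum A B), (col_mx f g); split.
- exact: hered_sum.
- by move=> x; rewrite /= tr_block_mx !trmx0 oA oB.
- by move=> x Gx; rewrite /= mul_block_col mul_col_mx !mul0mx addr0 add0r hf // hg.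
- by rewrite -addsmxE addsmx_sub fO.
- move=> j; rewrite inE -addsmxE => /orP[/eqP ->|/fP le].
    by apply: submx_trans gP (addsmxSr _ _).
  by apply: submx_trans le (addsmxSl _ _).
Qed.

Definition relabel (t : 'S_n.+1) w : word n := [ffun x => t (w x)].

Lemma relabel_wact t w g : relabel t (wact w g) = wact (relabel t w) g.
Proof. by apply/ffunP => x; rewrite !ffunE. Qed.

Lemma relabelK t w : relabel t^-1%g (relabel t w) = w.
Proof. by apply/ffunP => x; rewrite !ffunE permK. Qed.

Definition basis_map w w' (be : worb w -> worb w') :
    'M[k]_(gdim (wmod k w), gdim (wmod k w')) :=
  \matrix_i 'e_(enum_rank (be (enum_val i))).

Lemma row_basis_map w w' (be : worb w -> worb w') (u : worb w) :
  row (enum_rank u) (basis_map be) = b (be u).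
Proof. by rewrite rowK enum_rankK. Qed.

Lemma basis_mapK w w' (be : worb w -> worb w') be' : cancel be be' ->
  basis_map be *m basis_map be' = 1%:M.
Proof.
move=> beK; apply: eq_row_enum => u.
by rewrite row_mul row_basis_map -rowE row_basis_map beK row1.
Qed.

Lemma wmod_iso (t : 'S_n.+1) w w' h : relabel t w = wact w' h ->
  exists f : 'M_(gdim (wmod k w), gdim (wmod k w')),
    [/\ @ghom _ _ _ (wmod k w) (wmod k w') f, row_free f & row_full f].
Proof.
move=> E; have E' : relabel t^-1%g w' = wact w h^-1%g.
  by rewrite -[w](relabelK t) E relabel_wact -wactM mulgV wact1.
have in_orb t' v v' h' : relabel t' v = wact v' h' -> forall u : worb v,
    [exists g, relabel t' (val u) == wact v' g].
  move=> tE u; have [g ->] := base_trans u; apply/existsP; exists (h' * g)%g.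
  by rewrite /= relabel_wact tE wactM.
pose be (u : worb w) : worb w' :=
  exist (fun v => [exists g, v == wact w' g]) _ (in_orb _ _ _ _ E u).
pose be' (u : worb w') : worb w :=
  exist (fun v => [exists g, v == wact w g]) _ (in_orb _ _ _ _ E' u).
have beK : cancel be be' by move=> u; apply: val_inj; rewrite /= relabelK.
have beK' : cancel be' be.
  by move=> u; apply: val_inj; rewrite /= -{1}[t]invgK relabelK.
exists (basis_map be); split.
- apply/permmod_homP => g _ u; rewrite !row_basis_map wmod_basis; congr (b _).
  by apply: val_inj; rewrite /= relabel_wact.
- by apply/row_freeP; exists (basis_map be'); apply: basis_mapK.
- by apply/row_fullP; exists (basis_map be'); apply: basis_mapK.
Qed.

(** Let O be the orthogonal of the Specht module E in W. Straightening makes O the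
    image of a sum A of permutation modules of larger shape; dually, W / E embeds
    in A. So O and W / E are hereditary, and so is W / (E + O). By
    two-out-of-three in W, the module (E + O) / O has T, and it is simple or
    zero by the submodule theorem. *)
Lemma hered_wmod_sorted w : shape_sorted w -> (forall v, T (wmod k v)) ->
  (forall v, (phi w < phi v)%N -> hered T (wmod k v)) -> hered T (wmod k w).
Proof.
move=> srt Tw IH; pose W := wmod k w; pose O := specht_perp k w.
have [A [f [sA oA hf fO fP]]] : exists A f, [/\ hered T A, orthogonal_mod A,
    @ghom _ _ _ A W f, (f <= O)%MS & (O <= f)%MS].
  pose P (u : worb w) (v : 'rV[k]_(gdim W)) := ~~ standard (val u) ->
    exists U : {pred worb w}, [/\ u \in U, v = \sum_(u' in U) b u' &
         forall u' : worb w, u' \in U -> u' != u -> ltw (val u') (val u)].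
  have /choice[v vP] (u : worb w) :
      exists v : 'rV[k]_(gdim W), P u v /\ exists A f, [/\ hered T A,
      orthogonal_mod A, @ghom _ _ _ A W f, (f <= O)%MS & (v <= f)%MS].
    case: (boolP (standard (val u))) => [std|nst].
      have [//|A [f [sA oA hf fO _]]] := @hered_family W O nat [::] (fun _ => 0).
      by exists 0; split; [rewrite /P std | exists A, f; rewrite sub0mx].
    have cE i : cnt (val u) i = cnt w i by have [g ->] := base_trans u; rewrite cnt_wact.
    have srtu : shape_sorted (val u) by move=> i i' lt; rewrite !cE srt.
    have [w' [r [lt r_inv ru rlt]]] := straighten srtu nst.
    have {}lt : (phi w < phi w')%N.
      by apply: leq_ltn_trans lt; apply/eq_leq/eq_bigr => i _; rewrite cE.
    have hr := @relmx_hom w' w r r_inv.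
    exists (row (enum_rank (base w')) (relmx w' w r)); split.
      exists (fun u' : worb w => r w' (val u')); split; [exact: ru | exact: row_relmx|].
      move=> u' ru' ne; apply: rlt => // [i|E]; last by case/eqP: ne; apply: val_inj.
      by have [g ->] := base_trans u'; rewrite cnt_wact cE.
    exists (wmod k w'), (relmx w' w r); split=> //; last exact: row_sub.
    - exact: IH.
    - exact: wmod_orthogonal.
    - exact: (hom_sub_specht_perp lt hr).
  have [//|A [f [sA oA hf fO fP]]] := @hered_family W O _ (enum {: worb w}) v.
    by move=> u _; apply: (vP u).2.
  exists A, f; split=> //; apply: specht_perp_spanned => // u nst.
  have [U [uU vE ltU]] := (vP u).1 nst; exists U; split=> //.
  by rewrite -vE fP // mem_enum.
have modE := specht_module k w; have modO := specht_perp_module k w.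
have fE : f *m (specht k w)^T = 0 by apply/sub_kermxP.
have hft : @ghom _ _ _ W A f^T.
  move=> g Sg; have := hf g^-1%g (groupVr Sg); move/(congr1 trmx).
  by rewrite !trmx_mul oA wmod_orthogonal invgK.
have Ef : specht k w *m f^T = 0 by apply: trmx_inj; rewrite trmx_mul trmxK fE trmx0.
have kerft : (kermx f^T <= specht k w)%MS.
  (* the inclusion of E in the kernel is an equality of dimensions *)
  have Eft : (specht k w <= kermx f^T)%MS by apply/sub_kermxP.
  rewrite -(geq_leqif (mxrank_leqif_sup Eft)).
  have fOE : \rank f = \rank O by apply/eqmx_rank/andP.
  rewrite mxrank_ker mxrank_tr fOE mxrank_ker mxrank_tr subKn //.
  exact: rank_leq_col.
(* D is W / E *)
have [S1 [D [eE [pE [sE eEE]]]]] := submodule_ses modE.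
have [_ _ [rE [tE [_ tE1 _ _ rtE]]]] := sE.
have [h hh hE] : exists2 h, @ghom _ _ _ D A h & f^T = pE *m h.
  by apply: (ses_cokerP sE hft); apply/sub_kermxP; rewrite eEE; apply/sub_kermxP.
have hD : hered T D.
  apply: (hered_sub hh _ sA); rewrite -kermx_eq0; apply/rowV0P => v /sub_kermxP vh.
  rewrite -[v]mulmx1 -tE1 mulmxA; have /submxP[y ->] : (v *m tE <= eE)%MS.
    rewrite eEE; apply: submx_trans kerft; apply/sub_kermxP.
    by rewrite hE mulmxA -(mulmxA v) tE1 mulmx1.
  by rewrite -mulmxA (ses_comp0 sE) mulmx0.
(* O' is O as a module and L is W / O *)
have [O' [L [o [pL [sO oE]]]]] := submodule_ses modO.
have [ho hpL [rO [tL [orO tL1 _ _ _]]]] := sO.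
have free_o : row_free o by apply/row_freeP; exists rO.
have hO' : hered T O'.
  have /submxP[h' h'E] : (f <= o)%MS by rewrite oE.
  have hh' : @ghom _ _ _ A O' h' by apply: (ghom_cancelr ho free_o); rewrite -h'E.
  apply: (hered_quot hh' _ sA).
  have /submxP[y yE] : (o <= f)%MS by rewrite oE.
  apply/row_fullP; exists y; apply: (free_mono free_o).
  by rewrite -mulmxA -h'E -yE mul1mx.
have TL : T L := thick_quot tT sO (hered_self hO') (Tw w).
have modEL : mxmodule L (specht k w *m pL).
  apply/mxmoduleP => g Sg; rewrite -mulmxA -hpL // mulmxA submxMr //.
  exact: (mxmoduleP modE).
(* D1 is (E + O) / O and D2 is W / (E + O) *)
have [D1 [D2 [d1 [p2 [sD d1E]]]]] := submodule_ses modEL.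
have [hd1 hp2 [r1 [t2 [d1r1 t2p2 _ _ _]]]] := sD.
have free_d1 : row_free d1 by apply/row_freeP; exists r1.
have hD2 : hered T D2.
  have [|q hq qE] := @ses_cokerP _ _ _ _ _ _ _ _ sE D2 (pL *m p2) (ghom_mul hpL hp2).
    have /submxP[y ->] : (eE <= specht k w)%MS by rewrite eEE.
    rewrite -mulmxA [specht k w *m _]mulmxA.
    have /submxP[z ->] : (specht k w *m pL <= d1)%MS by rewrite d1E.
    by rewrite -(mulmxA z) (ses_comp0 sD) !mulmx0.
  apply: (hered_quot hq _ hD); apply/row_fullP; exists (t2 *m tL *m pE).
  by rewrite -!mulmxA -qE [tL *m _]mulmxA tL1 mul1mx.
have hD1 : hered T D1.
  apply: (hered_simple tT (thick_sub tT sD TL (hered_self hD2))) => U modU.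
  (* the preimage of U in W *)
  pose U' := kermx (pL *m cokermx (U *m d1)).
  have U'P m (v : 'M_(m, _)) : (v <= U')%MS = (v *m pL <= U *m d1)%MS.
    by rewrite [RHS]submxE -mulmxA; apply/sub_kermxP/eqP.
  have modU' : mxmodule W U'.
    apply/mxmoduleP => g Sg; rewrite U'P -mulmxA hpL // mulmxA.
    have /submxP[y ->] : (U' *m pL <= U *m d1)%MS by rewrite -U'P.
    rewrite -!mulmxA -hd1 // mulmx_sub // mulmxA submxMr //.
    exact: (mxmoduleP modU).
  have [|U'O] := submodule_dichotomy modU'; last first.
    left; apply: (free_mono free_d1); rewrite mul0mx.
    have /submxP[y yE] : (U *m d1 *m tL <= o)%MS.
      rewrite oE; apply: (submx_trans _ U'O); rewrite U'P -mulmxA tL1 mulmx1 //.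
    by rewrite -[LHS]mulmx1 -tL1 mulmxA yE -mulmxA (ses_comp0 sO) mulmx0.
  rewrite U'P => EU; right; have /submxP[y yE] : (d1 <= U *m d1)%MS by rewrite d1E.
  apply/row_fullP; exists y; apply: (free_mono free_d1).
  by rewrite -mulmxA -yE mul1mx.
exact: (hered_ext tT sO hO' (hered_ext tT sD hD1 hD2)).
Qed.

End Generation.

Section AllModules.
Variables (k : fieldType) (n : nat).
Local Notation S := [set: 'S_n]%G.
Implicit Types (u v w : word n) (A B M N : gmod k S).

Lemma cnt_relabel t w i : cnt (relabel t w) (t i) = cnt w i.
Proof. by apply: eq_card => x; rewrite !inE ffunE (inj_eq perm_inj). Qed.

Lemma phi_relabel t w : phi (relabel t w) = phi w.
Proof.
rewrite /phi (reindex_inj (@perm_inj _ t)) /=.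
by apply: eq_bigr => i _; rewrite cnt_relabel.
Qed.

Lemma sort_letters w : exists t, shape_sorted (relabel t w).
Proof.
pose r (i j : 'I_n.+1) := (cnt w j <= cnt w i)%N.
have r_total : total r by move=> i j; apply: leq_total.
have r_trans : transitive r by move=> i j l ij jl; apply: leq_trans jl ij.
have /tuple_permP[p pE] : perm_eq (sort r (enum 'I_n.+1)) (ord_tuple n.+1).
  by rewrite perm_sort val_ord_tuple.
exists p^-1%g => i j ij.
have cE l : cnt (relabel p^-1%g w) l = cnt w (p l).
  by rewrite -{1}[l](permK p) cnt_relabel.
have nthE (l : 'I_n.+1) : nth ord0 (sort r (enum 'I_n.+1)) l = p l.
  by rewrite pE (nth_map l) ?size_enum_ord // nth_ord_enum tnth_ord_tuple.
have := sorted_ltn_nth r_trans ord0 (sort_sorted r_total (enum 'I_n.+1)) i j.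
rewrite !inE size_sort size_enum_ord !ltn_ord => /(_ isT isT ij).
by rewrite !cE !nthE.
Qed.

Variable T : gmod k S -> Prop.
Hypothesis tT : thick T.

Lemma hered_wmod : (forall v, T (wmod k v)) -> forall w, hered T (wmod k w).
Proof.
move=> Tw w; pose m := (n.+1 * 2 ^ n)%N.
have phi_le v : (phi v <= m)%N.
  rewrite /m -[X in (X * _)%N]card_ord -sum_nat_const; apply: leq_sum => i _.
  apply: leq_trans (leq_subr _ _) _; rewrite leq_exp2l //.
  by rewrite -[X in (_ <= X)%N]card_ord max_card.
have [d] := ubnP (m - phi w); elim: d w => // d IHd w ltd.
have [t srt] := sort_letters w.
have [f [hf ff uf]] := @wmod_iso k n t w (relabel t w) 1%g (esym (wact1 _)).
apply: (hered_sub hf ff); apply: (hered_wmod_sorted tT srt Tw) => v.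
rewrite phi_relabel => lt; apply: IHd; have := phi_le v; lia.
Qed.

(** A word with distinct letters generates the regular module, and every module is a
    sum of quotients of it. *)
Lemma hered_all : (forall v, T (wmod k v)) -> forall N, T N.
Proof.
move=> Tw N; apply: hered_self.
pose w : word n := [ffun x : 'I_n => inord x].
have w_inj : injective w.
  move=> x y; rewrite !ffunE => /(congr1 val); rewrite /= !inordK ?ltnS 1?ltnW //.
  exact: val_inj.
have /fin_all_exists[g gE] (u : worb w) := base_trans u.
have g_inj h h' : oact (base w) h = oact (base w) h' -> h = h'.
  move/(congr1 val)/ffunP => E; apply: invg_inj; apply/permP => x.
  by apply: w_inj; have := E x; rewrite /= [wact w h x]ffunE [wact w h' x]ffunE.
have [//|A [f [sA _ hf _ fP]]] :=
  @hered_family k n T tT N 1%:M _ (enum 'I_(gdim N)) (fun i => 'e_i).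
  move=> i _; pose f : 'M_(gdim (wmod k w), gdim N) := \matrix_l ('e_i *m N (g (enum_val l))).
  exists (wmod k w), f; split; [exact: hered_wmod|exact: wmod_orthogonal| |exact: submx1|].
    apply/permmod_homP => x _ u; rewrite !rowK !enum_rankK -mulmxA -repr_mxM ?inE //.
    congr (_ *m N _); apply: g_inj; rewrite -gE oactM ?inE // -gE //.
  have -> : 'e_i = row (enum_rank (base w)) f.
    rewrite rowK enum_rankK (_ : g _ = 1%g) ?repr_mx1 ?mulmx1 //.
    by apply: g_inj; rewrite -gE oact1.
  exact: row_sub.
apply: (hered_quot hf _ sA).
rewrite -sub1mx; apply/row_subP => i; rewrite row1; apply: fP.
by rewrite mem_enum.
Qed.

End AllModules.

Section Compositions.
Variable n : nat.

Definition block_word (l : seq nat) : word n := [ffun x : 'I_n => inord (reshape_index l x)].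

Lemma reshape_index_cons a l x :
  reshape_index (a :: l) x = if (x < a)%N then 0%N else (reshape_index l (x - a)).+1.
Proof.
rewrite /reshape_index /= subn_eq0; case: ltnP => // ax.
by rewrite subSn.
Qed.

Lemma count_reshape_index l j :
  count (fun x => reshape_index l x == j) (iota 0 (sumn l)) = nth 0%N l j.
Proof.
elim: l j => [|a l IHl] j; first by rewrite nth_nil.
rewrite /= iotaD count_cat add0n.
have -> : count (fun x => reshape_index (a :: l) x == j) (iota 0 a) =
    if j is 0 then a else 0%N.
  transitivity (count (fun _ => 0%N == j) (iota 0 a)).
    by apply: eq_in_count => x; rewrite mem_iota /= reshape_index_cons => ->.
  by case: j => [|j]; rewrite ?count_predT ?size_iota ?count_pred0.
have -> : count (fun x => reshape_index (a :: l) x == j) (iota a (sumn l)) =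
    if j is j'.+1 then nth 0%N l j' else 0%N.
  rewrite -[X in iota X]addn0 iotaDl count_map.
  case: j => [|j]; last rewrite -IHl; last first.
    apply: eq_count => x /=; rewrite reshape_index_cons ltnNge leq_addr /= addKn //.
  rewrite -[RHS](count_pred0 (iota 0 (sumn l))); apply: eq_count => x /=.
  by rewrite reshape_index_cons ltnNge leq_addr.
by case: j => [|j]; rewrite ?addn0 ?add0n.
Qed.

Lemma composition_size l : composition n l -> (size l <= n)%N.
Proof.
case/andP=> + /eqP <-; elim: l => //= a l IHl /andP[a1 /IHl].
by lia.
Qed.

Lemma block_wordE l x : composition n l -> block_word l x = reshape_index l x :> nat.
Proof.
move=> cl; rewrite ffunE inordK // ltnS; apply: leq_trans (composition_size cl).
by apply/ltnW/reshape_indexP; case/andP: cl => _ /eqP ->.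
Qed.

Lemma cnt_block_word l i : composition n l -> cnt (block_word l) i = nth 0%N l i.
Proof.
move=> cl; rewrite -count_reshape_index; case/andP: (cl) => _ /eqP ->.
have -> : iota 0 n = index_iota 0 n by rewrite /index_iota subn0.
rewrite /cnt -sum1_card -sum1_count big_mkord; apply: eq_bigl => x.
by rewrite inE -(inj_eq val_inj) /= block_wordE.
Qed.

Lemma block_word_stab l s : composition n l ->
  (s \in young n l) = (wact (block_word l) s == block_word l).
Proof.
move=> cl; rewrite inE; apply/forallP/eqP => [E|/ffunP E x].
  apply/ffunP => x; apply: val_inj; rewrite /= ffunE !block_wordE //.
  by have /eqP := E (s^-1%g x); rewrite permKV.
have /(congr1 val) := E (s x); rewrite /= ffunE permK !block_wordE // => ->.
exact: eqxx.
Qed.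

Lemma sorted_word_block (w : word n) : shape_sorted w ->
  exists l h, composition n l /\ w = wact (block_word l) h.
Proof.
move=> srt; pose a := [seq cnt w i | i <- enum 'I_n.+1].
have aE (i : 'I_n.+1) : nth 0%N a i = cnt w i.
  by rewrite (nth_map i) ?size_enum_ord // nth_ord_enum.
pose l := [seq c <- a | (0 < c)%N].
have sum_a : sumn a = n.
  rewrite /a sumnE big_map -[RHS](card_ord n) -sum1_card (partition_big w predT) //=.
  rewrite big_enum /=; apply: eq_bigr => i _; rewrite /cnt -sum1_card.
  by apply: eq_bigl => x; rewrite inE.
have sum_l : sumn l = n.
  rewrite -sum_a /l; elim: (a) => //= -[|c] b IHb //=; by rewrite IHb.
have cl : composition n l by rewrite /composition sum_l eqxx andbT filter_all.
have nth_l j : nth 0%N l j = nth 0%N a j.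
  have srt_a : forall i j, (i < j)%N -> (nth 0%N a j <= nth 0%N a i)%N.
    move=> i j' ij; case: (ltnP j' n.+1) => [lt|ge]; last first.
      by rewrite nth_default // size_map size_enum_ord.
    by have := srt (Ordinal (ltn_trans ij lt)) (Ordinal lt) ij; rewrite -!aE.
  rewrite /l; elim: (a) srt_a j => //= -[|c] b IHb srt_b j /=.
    have b0 i : nth 0%N b i = 0%N by apply/eqP; rewrite -leqn0; apply: (srt_b 0%N i.+1).
    have -> : [seq c <- b | (0 < c)%N] = [::].
      rewrite (eq_in_filter (a2 := pred0)) ?filter_pred0 // => c /(nthP 0%N)[i _ <-].
      by rewrite b0.
    by case: j => [|j]; rewrite nth_nil /= ?b0.
  by case: j => [|j] //=; apply: IHb => i i' ii'; apply: (srt_b i.+1 i'.+1).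
have [i|h E] := @orbit_cnt n (block_word l) w.
  by rewrite cnt_block_word // nth_l aE.
by exists l, h.
Qed.

End Compositions.

(** The permutation modules on the cosets of Young subgroups generate all modules
    under two-out-of-three for short exact sequences. *)
Lemma young_generation (k : fieldType) n (T : gmod k [set: 'S_n] -> Prop) : thick T ->
  (forall l, composition n l -> T (wmod k (block_word n l))) -> forall N, T N.
Proof.
move=> tT Tl; apply: hered_all => // w; have [t srt] := sort_letters w.
have [l [h [cl E]]] := sorted_word_block srt.
have [f [hf ff uf]] := @wmod_iso k n t w (block_word n l) h E.
by apply/(thick_iso tT hf ff uf)/Tl.
Qed.

(** * Rates of growth and the theorem *)

Section RateOfGrowth.
Implicit Types (V : nat -> nat) (c : nat).

Lemma growth_leW V c d : (c <= d)%N -> growth_le V c -> growth_le V d.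
Proof. by move=> cd /growsP gV; apply/growsP/(growsW cd). Qed.

Lemma growth_rateP V c : (growth_rate V <= c%:Z%:E)%E <-> growth_le V c.
Proof.
rewrite /growth_rate; case: pselect => [exc|nexc]; last first.
  by split=> // gV; case: nexc; exists c; apply/asboolP.
case: ex_minnP => d /asboolP gd min_d; rewrite lee_fin lez_nat.
by split=> [dc|gc]; [apply: growth_leW gd | apply/min_d/asboolP].
Qed.

Lemma growth_rate_cases V :
  growth_rate V = +oo%E \/ exists c : nat, growth_rate V = c%:Z%:E.
Proof.
rewrite /growth_rate; case: pselect => [exc|_]; last by left.
by right; exists (ex_minn exc).
Qed.

(** Block words embed the compositions of n in a finite type. *)
Lemma composition_eq n l l' : composition n l -> composition n l' ->
  block_word n l = block_word n l' -> l = l'.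
Proof.
move=> cl cl' E; have nthE i : (i < n.+1)%N -> nth 0%N l i = nth 0%N l' i.
  move=> lt; rewrite -(cnt_block_word (Ordinal lt) cl) E.
  exact: cnt_block_word.
have size_le m m' : composition n m -> composition n m' ->
    (forall i, (i < n.+1)%N -> nth 0%N m i = nth 0%N m' i) -> (size m' <= size m)%N.
  move=> cm cm' mE; rewrite leqNgt; apply/negP => lt.
  have ltn := leq_trans lt (composition_size cm').
  have := mE (size m) (ltnW ltn); rewrite nth_default //.
  by case/andP: cm' => /(all_nthP 0%N)/(_ _ lt) + _; case: (nth 0%N m' (size m)).
have sE : size l = size l' by apply/eqP; rewrite eqn_leq !size_le // => i /nthE.
apply: (eq_from_nth (x0 := 0%N)) => // i lt; apply: nthE.
exact: ltnW (leq_trans lt (composition_size cl)).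
Qed.

(** If all the rates are finite they are bounded together, there being finitely many
    compositions; so the maximum is attained even when it is infinite. *)
Lemma is_max_growth n (F : seq nat -> nat -> nat) V : (0 < n)%N ->
  (forall c, growth_le V c <-> forall l, composition n l -> growth_le (F l) c) ->
  is_max (fun l => composition n l) (fun l => growth_rate (F l)) (growth_rate V).
Proof.
move=> n_gt0 VF; have ub l : composition n l -> (growth_rate (F l) <= growth_rate V)%E.
  move=> cl; have [->|[c cE]] := growth_rate_cases V; first by rewrite leey.
  by rewrite cE; apply/growth_rateP; move: l cl; apply/VF/growth_rateP; rewrite cE.
split=> //; apply: contrapT => none.
have lt l : composition n l -> (growth_rate (F l) < growth_rate V)%E.
  move=> cl; rewrite lt_neqAle ub // andbT; apply/eqP => E; apply: none.
  by exists l.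
have cn : composition n [:: n] by rewrite /composition /= n_gt0 addn0 eqxx.
have [Voo|[[|c] cE]] := growth_rate_cases V.
- have bound (w : word n) : exists c, forall l, composition n l -> block_word n l = w ->
      growth_le (F l) c.
    have [[l cl lE]|nl] :=
      pselect (exists2 l, composition n l & block_word n l = w); last first.
      by exists 0%N => l cl lE; case: nl; exists l.
    have [E|[c cE]] := growth_rate_cases (F l).
      by have := lt l cl; rewrite E Voo ltxx.
    exists c => l' cl' l'E; rewrite (composition_eq cl' cl) ?l'E //.
    by apply/growth_rateP; rewrite cE.
  have [c cP] := fin_all_exists bound.
  have : (growth_rate V <= (\max_w c w)%:Z%:E)%E.
    apply/growth_rateP/VF => l cl.
    by apply: growth_leW (cP _ l cl erefl); apply: leq_bigmax.
  by rewrite Voo.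
- have := lt _ cn; rewrite cE; have [->|[d ->]] := growth_rate_cases (F [:: n]) => //.
- have : (growth_rate V <= c%:Z%:E)%E.
    apply/growth_rateP/VF => l cl; apply/growth_rateP.
    have := lt l cl; rewrite cE; have [->|[d ->]] := growth_rate_cases (F l) => //.
  by rewrite cE lee_fin lez_nat ltnn.
Qed.

End RateOfGrowth.

Section YoungCohomology.
Variables (k : fieldType) (n : nat).
Local Notation S := [set: 'S_n]%G.
Variable Q : forall l : seq nat, resolution (triv_repr k (young n l)).
Implicit Types (N : gmod k S) (Z : nat -> gmod k S).

Local Notation res l := (gres (subsetT (young n l))).

Lemma gdual_triv (G : {group 'S_n}) : gdual (GMod (triv_repr k G)) = GMod (triv_repr k G).
Proof.
rewrite /gdual; congr GMod; move: (dual_mx_repr _) => /=.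
have -> : (fun x : 'S_n => (1%:M : 'M[k]_1)^T) = (fun x : 'S_n => 1%:M).
  by apply/funext => x; rewrite trmx1.
move=> h; rewrite /triv_repr; congr MxRepresentation; exact: Prop_irrelevance.
Qed.

(** Frobenius reciprocity turns Ext over the symmetric group into Ext over the Young
    subgroup H with trivial coefficients; dualising, Ext^t_H(Z 0, k) is
    Ext^t_H(k, (Z 0)^* ). *)
Lemma sdim_young Z l t : chain Z -> composition n l ->
  sdim (Z t.+1) (wmod k (block_word n l)) = dim_Ext (Q l) (gdual (res l (Z 0%N))) t.+1.
Proof.
move=> cZ cl; pose H := young n l.
have frob X : hdim X (wmod k (block_word n l)) = hdim (res l X) (GMod (triv_repr k H)).
  apply: (@hdim_frobenius _ _ _ _ _ _ _ _ _ (base (block_word n l))) => [s _|u].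
    rewrite block_word_stab //; apply/eqP/eqP => [E|/(congr1 val) //].
  by have [g ->] := base_trans u; exists g; rewrite ?inE.
have [P [i [p [pP ip]]]] := cZ t.
have -> : sdim (Z t.+1) (wmod k (block_word n l)) =
    sdim (res l (Z t.+1)) (GMod (triv_repr k H)).
  have := sdimE ip pP (wmod k (block_word n l)).
  have := sdimE (ses_res (subsetT H) ip) (relproj_res (subsetT H) pP) (GMod (triv_repr k H)).
  by rewrite !frob => <- /eqP; rewrite eqn_add2r => /eqP.
rewrite dim_Ext_sdim.
have cC := cochain_dual (chain_res (subsetT H) cZ).
by rewrite (sdim_chain_shift t.+1 (chain_syz (Q l)) cC) sdim_dual gdual_triv.
Qed.

(** Ext^t(Z 0, N) has growth at most c for every N. *)
Definition bounded Z c := forall N, grows (fun t => sdim (Z t) N) c.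

Lemma bounded_young Z c : chain Z -> bounded Z c <->
  (forall l, composition n l -> growth_le (dim_Ext (Q l) (gdual (res l (Z 0%N)))) c).
Proof.
move=> cZ; split=> [bZ l cl|gZ].
  apply/growsP; apply: grows_le (bZ (wmod k (block_word n l))) => -[//|t] _.
  by rewrite sdim_young.
apply: young_generation; first exact: thick_chain.
move=> l cl; have /growsP := gZ l cl; apply: grows_le => -[//|t] _.
by rewrite sdim_young.
Qed.

Lemma bounded_dual Z Z' c : chain Z -> chain Z' -> Z' 0%N = gdual (Z 0%N) ->
  bounded Z c -> bounded Z' c.
Proof.
move=> cZ cZ' E bZ N; have [N' le] := sdim_dual_chain N cZ cZ' E.
by apply: grows_le (bZ N') => t _.
Qed.

End YoungCohomology.

Theorem theorem2p2 (k : closedFieldType) (p : nat) (charp : p \in [pchar k])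
    (n : nat) (n_gt0 : (1 <= n)%N)
    (m : nat) (M : mx_representation k [set: 'S_n] m)
    (P : resolution M) (minP : minimal P)
    (Q : forall l : seq nat, resolution (triv_repr k (young n l))) :
  is_max (fun l => composition n l)
    (fun l => growth_rate (dim_Ext (Q l) (young_res M l)))
    (growth_rate (rdim P)) /\
  is_max (fun l => composition n l)
    (fun l => growth_rate (dim_Tor (Q l) (young_res M l)))
    (growth_rate (rdim P)).
Proof.
have cZ := chain_syz P.
have [C cC C0] := cochain_exists (GMod M).
have cZ' := chain_dual cC.
have growM c : growth_le (rdim P) c <-> bounded (syz P) c.
  by split=> [/growsP/(minimal_grows minP)|/(minimal_grows minP)/growsP].
have growM' c : growth_le (rdim P) c <-> bounded (fun t => gdual (C t)) c.
  split=> [/growM|bM]; first by apply: bounded_dual; rewrite ?C0.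
  by apply/growM; apply: bounded_dual bM; rewrite //= C0 gdualK.
split; apply: is_max_growth => // c.
  apply: iff_trans (growM' c) (iff_trans (bounded_young Q c cZ') _).
  have E l : gdual (gres (subsetT (young n l)) (gdual (C 0%N))) = GMod (young_res M l).
    by rewrite gdual_res gdualK C0.
  by split=> gM l cl; have := gM l cl; rewrite E.
apply: iff_trans (growM c) (iff_trans (bounded_young Q c cZ) _).
have E l : dim_Tor (Q l) (young_res M l) = dim_Ext (Q l) (gdual (GMod (young_res M l))).
  by apply/funext => t; rewrite -dim_Tor_Ext.
by split=> gM l cl; have := gM l cl; rewrite E.
Qed.
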